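(* Let $G$ be a connected bipartite $k$-regular graph, where $k\geqslant 3$. If $R(G)>\sqrt{k-2}$, then $R(G)=\sqrt{k-1}$ and $G$ is the incidence graph of a projective plane of order $k-1$.
   Context: All graphs are simple (no loops or multiple edges). For a graph $G$ of order $n$ with adjacency eigenvalues $\lambda_1\geqslant\cdots\geqslant\lambda_n$, the HL-index is $R(G)=\max\{|\lambda_{\lfloor (n+1)/2\rfloor}|,\ |\lambda_{\lceil (n+1)/2\rceil}|\}$. The incidence graph of a projective plane is the bipartite graph whose two parts are the points and the lines of the plane, a point being adjacent to a line iff it lies on it. *)

(* Defs.v *)
(* Eigenvalues are taken in algC (algebraic complex numbers),
   an algebraically closed numeric field containing all eigenvalues of an
   integer matrix; for a symmetric adjacency matrix they are all real. *)
From HB Require Import structures.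
From mathcomp Require Import all_boot all_order all_algebra all_field.
Set Implicit Arguments. Unset Strict Implicit. Unset Printing Implicit Defensive.
Import Order.TTheory GRing.Theory Num.Theory.
Local Open Scope ring_scope.

Definition simple_graph (n : nat) (e : rel 'I_n) : Prop :=
  (forall i j, e i j = e j i) /\ (forall i, ~~ e i i).

Definition connected_graph (n : nat) (e : rel 'I_n) : Prop :=
  forall i j, connect e i j.

Definition bipartite_graph (n : nat) (e : rel 'I_n) : Prop :=
  exists f : 'I_n -> bool, forall i j, e i j -> f i != f j.

Definition regular_graph (n : nat) (e : rel 'I_n) (k : nat) : Prop :=
  forall i, #|[set j | e i j]| = k.

Definition adj_mx (n : nat) (e : rel 'I_n) : 'M[algC]_n :=
  \matrix_(i, j) (e i j)%:R.

(* The multiset of eigenvalues (roots of the characteristic polynomial,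
   with multiplicity), sorted nonincreasingly: lambda_1 >= ... >= lambda_n. *)
Definition spectrum (n : nat) (A : 'M[algC]_n) : seq algC :=
  sort (fun x y : algC => y <= x) (sval (closed_field_poly_normal (char_poly A))).

(* 1-based eigenvalue lambda_m, m in 1..n. *)
Definition eig (n : nat) (A : 'M[algC]_n) (m : nat) : algC :=
  nth 0 (spectrum A) m.-1.

Definition HL_index (n : nat) (e : rel 'I_n) : algC :=
  Num.max `|eig (adj_mx e) (n.+1)./2| `|eig (adj_mx e) (uphalf n.+1)|.

Definition projective_plane (P L : finType) (I : P -> L -> bool) : Prop :=
  (forall p1 p2 : P, p1 != p2 -> exists! l : L, I p1 l && I p2 l) /\
  (forall l1 l2 : L, l1 != l2 -> exists! p : P, I p l1 && I p l2) /\
  (exists p1 p2 p3 p4 : P, uniq [:: p1; p2; p3; p4] /\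
     forall l : L, (I p1 l + I p2 l + I p3 l + I p4 l <= 2)%N).

Definition projective_plane_of_order (P L : finType) (I : P -> L -> bool)
  (q : nat) : Prop :=
  projective_plane I /\ forall l : L, #|[set p | I p l]| = q.+1.

Definition incidence_rel (P L : finType) (I : P -> L -> bool) : rel (P + L) :=
  fun u v => match u, v with
             | inl p, inr l => I p l
             | inr l, inl p => I p l
             | _, _ => false
             end.

Definition is_incidence_graph_of_projective_plane (n : nat) (e : rel 'I_n)
  (q : nat) : Prop :=
  exists (P L : finType) (I : P -> L -> bool),
    projective_plane_of_order I q /\
    exists phi : 'I_n -> P + L, bijective phi /\
      forall i j, e i j = incidence_rel I (phi i) (phi j).

(* Main.v *)
(* If the HL-index exceeds sqrt(k - 2), the symmetry of the spectrum of a bipartite graph gives A^2 - (k - 2) > 0. The off-diagonal entries of this matrix are therefore 0 or 1: G has no 4-cycle, and the collinearity graph h of the points (two points being adjacent if they are on a common line), and dually that of the lines, is k(k - 1)-regular with least eigenvalue > -2.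

Let Q be a maximum clique of h on one side, of size s. Projecting away from Q keeps the form positive definite on the vertices outside Q, which leaves very few exotic vertices, that is, outside vertices with at least two neighbours in Q (at most one if s > 6), and forces the private neighbours of all but one vertex of Q to form a clique. Counting degrees then gives s > k when k > 3, and all lines through some point of Q lie in Q up to one exotic point; for k = 3 the sizes s = 3, 4, 5, 6 are excluded by explicit vectors on which the form is not positive. Hence Q is closed under h, so it is the whole side by connectedness: any two points are joined, any two lines meet, and A^2 = (k - 1) I + J on each side yields the HL-index. *)

Require Import Defs.
From HB Require Import structures.
From mathcomp Require Import all_boot all_order all_algebra all_field.
From mathcomp Require Import spectral zify ring.
Import Order.TTheory GRing.Theory Num.Theory.
Local Open Scope ring_scope.

Set Implicit Arguments. Unset Strict Implicit. Unset Printing Implicit Defensive.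

(** The Gram matrix of a clique of size s is I + J, with inverse I - J / (s + 1), so projections
    away from it become integral after scaling by s + 1. Let tau count the neighbours of a vertex in
    [Q]. The scaled product of two outside vertices is congruent to the product of their tau modulo
    s + 1, and the scaled norm is 4 - a b, where a = tau - 2 and b = s - tau - 1. Exotic vertices
    thus have norm at most 4 and, by strict Cauchy-Schwarz, products strictly between -4 and 4: the
    congruence leaves almost no choice. For s > 6 the residues 4 and -4 have no representative in
    that range, hence the bound 6. The obstacle is that a clique of [h] need not lie on a line. A
    maximum clique of size k is therefore chosen to be a line. For k = 3 the degree 6 is too small
    for counting to settle s = 3, 4, 5, and the configurations of lines around [Q] must be analysed.
    All vertices, points and lines alike, live in one type [T], and [h] is defined on both sides at
    once, so each argument covers its dual. *)

Section PositiveDefiniteGraph.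

(** * Projection away from a clique in a positive definite graph *)

Variables (T : finType) (h : rel T).
Implicit Types (Q : {set T}) (x y z t u v : T).

Definition gram (x y : T) : int := (2 * (x == y) + h x y)%N.

Hypothesis h_sym : forall x y, h x y = h y x.
Hypothesis h_irr : forall x, h x x = false.
Hypothesis gram_pos : forall a : T -> int, (exists x, a x != 0) ->
  0 < \sum_x \sum_y a x * a y * gram x y.

Definition clique (Q : {set T}) : Prop :=
  forall x y, x \in Q -> y \in Q -> x != y -> h x y.

Definition nbrs (Q : {set T}) (x : T) : nat := \sum_(q in Q) h x q.

Definition common (Q : {set T}) (x y : T) : nat := \sum_(q in Q) h x q * h y q.

(* Realise the vertices by vectors with Gram matrix [gram]. For a clique [Q], [lift_res Q x] is [#|Q| + 1] times the projection of [x] to the orthogonal complement of the span of [Q], and [res Q] is [#|Q| + 1] times the Gram matrix of these projections. *)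
Definition res (Q : {set T}) (x y : T) : int :=
  #|Q|.+1%:Z * (gram x y - (common Q x y)%:Z) + (nbrs Q x)%:Z * (nbrs Q y)%:Z.

Definition lift_res (Q : {set T}) (x t : T) : int :=
  if t \in Q then (nbrs Q x)%:Z - #|Q|.+1%:Z * (h x t)%:Z
  else #|Q|.+1%:Z * (t == x)%:Z.

Lemma gram_sym x y : gram x y = gram y x.
Proof. by rewrite /gram h_sym eq_sym. Qed.

Lemma common_sym Q x y : common Q x y = common Q y x.
Proof. by apply: eq_bigr => q _; rewrite mulnC. Qed.

Lemma res_sym Q x y : res Q x y = res Q y x.
Proof. by rewrite /res gram_sym common_sym [(nbrs Q x)%:Z * _]mulrC. Qed.

Lemma gram_clique Q x y : clique Q -> x \in Q -> y \in Q ->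
  gram x y = 1 + (x == y)%:Z.
Proof.
move=> cQ xQ yQ; rewrite /gram; have [->|ne] := eqVneq x y.
  by rewrite h_irr.
by rewrite cQ.
Qed.

Lemma sum_lift_resE Q x t :
  x \notin Q ->
  \sum_u lift_res Q x u * gram t u =
  #|Q|.+1%:Z * gram t x + \sum_(u in Q) ((nbrs Q x)%:Z - #|Q|.+1%:Z * (h x u)%:Z) * gram t u.
Proof.
move=> xQ; rewrite (bigID (mem Q)) /= addrC; congr (_ + _).
  rewrite (bigD1 x) //= big1 ?addr0; last first.
    by move=> i /andP[/negPf iQ /negPf ix]; rewrite /lift_res iQ ix mulr0 mul0r.
  by rewrite /lift_res (negPf xQ) eqxx mulr1.
by apply: eq_bigr => i iQ; rewrite /lift_res iQ.
Qed.

Lemma sum_nbrs Q x : \sum_(u in Q) (h x u)%:Z = (nbrs Q x)%:Z.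
Proof. by rewrite /nbrs (big_morph Posz PoszD (erefl _)). Qed.

(** Orthogonality to [Q]: the coefficients in [lift_res] come from inverting the Gram matrix I + J
    of the clique. *)
Lemma sum_lift_res_in Q x t : clique Q -> x \notin Q -> t \in Q ->
  \sum_u lift_res Q x u * gram t u = 0.
Proof.
move=> cQ xQ tQ; rewrite sum_lift_resE //.
under eq_bigr => u uQ do rewrite (gram_clique cQ) // mulrDr mulr1.
rewrite big_split /= sumrB sumr_const -mulr_sumr sum_nbrs (bigD1 t) //=.
rewrite eqxx mulr1 big1 ?addr0; last first.
  by move=> u /andP[_ /negPf ut]; rewrite eq_sym ut mulr0.
rewrite -[_ *+ _]mulr_natr natz /gram h_sym.
have -> : (t == x) = false by apply/negbTE; apply: contraNneq xQ => <-.
rewrite muln0 add0n; ring.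
Qed.

Lemma sum_lift_res_out Q x t : x \notin Q -> t \notin Q ->
  \sum_u lift_res Q x u * gram t u = res Q x t.
Proof.
move=> xQ tQ; rewrite sum_lift_resE //.
rewrite (eq_bigr (fun u => (nbrs Q x)%:Z * (h t u)%:Z -
   #|Q|.+1%:Z * (h x u * h t u)%N%:Z)); last first.
  move=> u uQ; rewrite /gram.
  have -> : (t == u) = false by apply/negbTE; apply: contraNneq tQ => ->.
  rewrite muln0 add0n PoszM; ring.
rewrite sumrB -!mulr_sumr sum_nbrs /res gram_sym.
have -> : \sum_(u in Q) (h x u * h t u)%N%:Z = (common Q x t)%:Z.
  by rewrite /common (big_morph Posz PoszD (erefl _)).
ring.
Qed.

(** Evaluate [gram] at the combination [a] of the lifts. Each lift is orthogonal to [Q] and, outside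
    [Q], supported on its own vertex with coefficient [#|Q| + 1], so only that coordinate survives.
    Distinctness of the vertices makes [a] nonzero. *)
Lemma res_pos Q (L : seq (int * T)) : clique Q ->
  uniq (unzip2 L) -> {in L, forall p, p.2 \notin Q} -> has (fun p => p.1 != 0) L ->
  0 < \sum_(p <- L) \sum_(r <- L) p.1 * r.1 * res Q p.2 r.2.
Proof.
move=> cQ uL LQ /hasP[p0 p0L p0n].
pose a t := \sum_(p <- L) p.1 * lift_res Q p.2 t.
have an0 : exists x, a x != 0.
  exists p0.2; rewrite /a (bigD1_seq p0) ?(map_uniq uL) //= big_seq_cond big1.
    rewrite addr0 /lift_res (negPf (LQ _ p0L)) eqxx.
    by rewrite mulr1 mulf_neq0.
  move=> p /andP[pL pp0]; rewrite /lift_res (negPf (LQ _ p0L)).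
  rewrite (_ : (p0.2 == p.2) = false) ?mulr0 //.
  apply/negbTE; apply: contra pp0 => /eqP e2; apply/eqP.
  have i1 : (index p L < size L)%N by rewrite index_mem.
  have i2 : (index p0 L < size L)%N by rewrite index_mem.
  rewrite -[LHS](nth_index p0 pL) -[RHS](nth_index p0 p0L); congr nth.
  apply/eqP; rewrite -(nth_uniq p0.2 _ _ uL) ?size_map //.
  by rewrite !(nth_map p0) // !nth_index // e2.
have := gram_pos an0.
rewrite (_ : \sum_x _ = #|Q|.+1%:Z *
  \sum_(p <- L) \sum_(r <- L) p.1 * r.1 * res Q p.2 r.2); last first.
  rewrite /a.
  transitivity (\sum_(p <- L) \sum_(r <- L) p.1 * r.1 *
     \sum_x lift_res Q p.2 x * \sum_y lift_res Q r.2 y * gram x y).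
    transitivity (\sum_x \sum_(p <- L) \sum_(r <- L) p.1 * r.1 *
        (lift_res Q p.2 x * \sum_y lift_res Q r.2 y * gram x y)).
      apply: eq_bigr => x _.
      transitivity ((\sum_(p <- L) p.1 * lift_res Q p.2 x) *
        \sum_y (\sum_(r <- L) r.1 * lift_res Q r.2 y) * gram x y).
        by rewrite mulr_sumr; apply: eq_bigr => y _; rewrite mulrA.
      rewrite mulr_suml; apply: eq_bigr => p _.
      transitivity (p.1 * lift_res Q p.2 x * \sum_(r <- L) \sum_y
         (r.1 * lift_res Q r.2 y) * gram x y).
        congr (_ * _); rewrite exchange_big /=; apply: eq_bigr => y _.
        by rewrite mulr_suml.
      rewrite mulr_sumr; apply: eq_bigr => r _.
      under eq_bigr => y _ do rewrite -mulrA.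
      rewrite -mulr_sumr; ring.
    rewrite exchange_big /=; apply: eq_bigr => p _.
    rewrite exchange_big /=; apply: eq_bigr => r _.
    by rewrite mulr_sumr.
  rewrite mulr_sumr !big_seq; apply: eq_bigr => p pL.
  rewrite mulr_sumr !big_seq; apply: eq_bigr => r rL.
  have [pQ rQ] := (LQ _ pL, LQ _ rL).
  rewrite (bigID (mem Q)) /= big1 ?add0r; last first.
    by move=> x xQ; rewrite sum_lift_res_in ?mulr0.
  rewrite (bigD1 p.2) //= [X in _ + X]big1 ?addr0; last first.
    by move=> x /andP[/negPf xQ /negPf xp]; rewrite /lift_res xQ xp mulr0 mul0r.
  rewrite sum_lift_res_out // /lift_res (negPf pQ) eqxx mulr1 (res_sym Q r.2); ring.
by rewrite pmulr_rgt0.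
Qed.

Definition res_norm Q x : int := (#|Q|.+1%:Z) * (2 - (nbrs Q x)%:Z) + (nbrs Q x)%:Z ^+ 2.

Lemma res_xx Q x : res Q x x = res_norm Q x.
Proof.
rewrite /res /res_norm /gram eqxx h_irr.
have -> : common Q x x = nbrs Q x.
  by apply: eq_bigr => q _; case: (h x q).
by [].
Qed.

Lemma res_norm_gt0 Q x : clique Q -> x \notin Q -> 0 < res_norm Q x.
Proof.
move=> cQ xQ; have := @res_pos Q [:: (1, x)] cQ isT.
rewrite !big_seq1 !mul1r res_xx; apply=> //.
by move=> p; rewrite inE => /eqP ->.
Qed.

Lemma res_xy Q x y : x != y ->
  res Q x y = (#|Q|.+1%:Z) * ((h x y)%:Z - (common Q x y)%:Z) + (nbrs Q x)%:Z * (nbrs Q y)%:Z.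
Proof. by move=> /negPf xy; rewrite /res /gram xy. Qed.

(** Strict Cauchy-Schwarz: on the weights [res_norm Q y] and [- res Q x y] the form equals
    [res_norm Q y] times the 2 by 2 Gram determinant. *)
Lemma res_pair Q x y : clique Q -> x \notin Q -> y \notin Q -> x != y ->
  res Q x y ^+ 2 < res_norm Q x * res_norm Q y.
Proof.
move=> cQ xQ yQ xy.
have ny : 0 < res_norm Q y by exact: res_norm_gt0.
have := @res_pos Q [:: (res_norm Q y, x); (- res Q x y, y)] cQ.
rewrite /= inE xy /= => /(_ isT); rewrite !big_cons !big_nil /= !res_xx (res_sym Q y x).
move=> H.
have /H : {in [:: (res_norm Q y, x); (- res Q x y, y)], forall p : int * T, p.2 \notin Q}.
  by move=> p; rewrite !inE => /orP[] /eqP ->.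
rewrite gt_eqF //= => /(_ isT); rewrite !addr0 => H'.
rewrite -subr_gt0 -(pmulr_rgt0 _ ny); by congr (0 < _): H'; ring.
Qed.

(** The form of [res_pos] as diagonal plus twice the upper triangle: on a concrete list it unfolds
    to an explicit sum with each pair occurring once. *)
Fixpoint res_quad Q (L : seq (int * T)) : int :=
  if L is p :: L' then
    p.1 ^+ 2 * res_norm Q p.2 +
    2 * p.1 * (\sum_(r <- L') r.1 * res Q p.2 r.2) + res_quad Q L'
  else 0.

Lemma res_quad_pos Q (L : seq (int * T)) : clique Q -> uniq (unzip2 L) ->
  all (fun p => p.2 \notin Q) L -> has (fun p => p.1 != 0) L -> 0 < res_quad Q L.
Proof.
move=> cQ uL /allP LQ hL; have := res_pos cQ uL LQ hL; congr (0 < _).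
elim: L {uL LQ hL} => [|p L IH] /=; first by rewrite big_nil.
rewrite big_cons [X in X + _]big_cons res_xx.
have -> : \sum_(r <- L) \sum_(r' <- p :: L) r.1 * r'.1 * res Q r.2 r'.2 =
  \sum_(r <- L) (r.1 * p.1 * res Q p.2 r.2 +
     \sum_(r' <- L) r.1 * r'.1 * res Q r.2 r'.2).
  by apply: eq_bigr => r _; rewrite big_cons (res_sym Q r.2).
rewrite big_split /= IH.
have -> : \sum_(r <- L) p.1 * r.1 * res Q p.2 r.2 =
  \sum_(r <- L) p.1 * (r.1 * res Q p.2 r.2) by apply: eq_bigr => r _; rewrite mulrA.
have -> : \sum_(r <- L) r.1 * p.1 * res Q p.2 r.2 =
  \sum_(r <- L) p.1 * (r.1 * res Q p.2 r.2) by apply: eq_bigr => r _; ring.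
rewrite -!mulr_sumr; ring.
Qed.

(** * Vertices outside a maximum clique and their residues *)

Variable Q : {set T}.
Hypothesis cQ : clique Q.
(* Only cliques meeting [Q] are compared with [Q]: other connected components may have larger ones. *)
Hypothesis Qmax : forall (K : {set T}) q, q \in K -> q \in Q -> clique K ->
  (#|K| <= #|Q|)%N.

Local Notation s := #|Q|.
Local Notation tau := (nbrs Q).

Definition exotic x := (x \notin Q) && (1 < tau x)%N.

Lemma nbrsE x : tau x = #|[set q in Q | h x q]|.
Proof.
rewrite /nbrs -sum1_card big_mkcond [RHS]big_mkcond; apply: eq_bigr => q _.
by rewrite inE; case: (q \in Q); case: (h x q).
Qed.

Lemma commonE x y : common Q x y = #|[set q in Q | h x q && h y q]|.
Proof.
rewrite /common -sum1_card big_mkcond [RHS]big_mkcond; apply: eq_bigr => q _.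
by rewrite inE; case: (q \in Q); case: (h x q); case: (h y q).
Qed.

Lemma clique_sub (A B : {set T}) : A \subset B -> clique B -> clique A.
Proof. by move=> /subsetP AB cB x y /AB xB /AB yB; apply: cB. Qed.

Lemma clique_setU1 (K : {set T}) x : clique K -> (forall y, y \in K -> h x y) ->
  clique (x |: K).
Proof.
move=> cK hx y z; rewrite !inE => /predU1P[->|yK] /predU1P[->|zK] yz.
- by rewrite eqxx in yz.
- exact: hx.
- by rewrite h_sym hx.
- exact: cK.
Qed.

(** The vertex together with its neighbours in [Q] is a clique; positivity of [tau x] makes it meet
    [Q], as [Qmax] requires. [common_lt] is the analogue for an adjacent pair. *)
Lemma nbrs_lt x : x \notin Q -> (0 < tau x)%N -> (tau x < s)%N.
Proof.
rewrite nbrsE => xQ /card_gt0P[q]; rewrite inE => /andP[qQ hq].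
set K := [set q in Q | h x q].
have <- : #|x |: K| = #|K|.+1 by rewrite cardsU1 inE (negPf xQ).
apply: (Qmax (q := q)) => //; first by rewrite !inE qQ hq orbT.
apply: clique_setU1; last by move=> y; rewrite inE => /andP[].
by apply: clique_sub cQ; apply/subsetP => y; rewrite inE => /andP[].
Qed.

Lemma common_lt x y : x \notin Q -> y \notin Q -> h x y -> (0 < common Q x y)%N ->
  ((common Q x y).+2 <= s)%N.
Proof.
rewrite commonE => xQ yQ hxy /card_gt0P[q]; rewrite inE => /and3P[qQ hxq hyq].
set K := [set q in Q | _].
have <- : #|x |: (y |: K)| = #|K|.+2.
  rewrite !cardsU1 !inE (negPf xQ) (negPf yQ) !orbF.
  by rewrite (_ : x != y) //; apply: contraTneq hxy => ->; rewrite h_irr.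
apply: (Qmax (q := q)) => //; first by rewrite !inE qQ hxq hyq !orbT.
apply: clique_setU1; last first.
  by move=> z; rewrite !inE => /predU1P[->//|/and3P[]].
apply: clique_setU1; last by move=> z; rewrite inE => /and3P[].
by apply: clique_sub cQ; apply/subsetP => z; rewrite inE => /andP[].
Qed.

Lemma common_le x y : (common Q x y <= tau x)%N.
Proof. by apply: leq_sum => q _; case: (h x q); case: (h y q). Qed.

Lemma common_le_r x y : (common Q x y <= tau y)%N.
Proof. by rewrite common_sym common_le. Qed.

Lemma nbrs1P x r : r \in Q -> h x r -> tau x = 1%N ->
  forall q, q \in Q -> h x q = (q == r).
Proof.
move=> rQ hxr; rewrite nbrsE => /eqP/cards1P[r' E] q qQ.
have : r \in [set r'] by rewrite -E inE rQ.
by rewrite inE => /eqP ->; rewrite -[q == r']in_set1 -E inE qQ.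
Qed.

Lemma common1 x y r : r \in Q -> h x r -> tau x = 1%N -> common Q x y = h y r.
Proof.
move=> rQ hxr t1; rewrite /common (bigD1 r) //= hxr mul1n big1 ?addn0 //.
by move=> q /andP[qQ /negPf qr]; rewrite (nbrs1P rQ hxr) // qr.
Qed.

(** Test vector x + y - u - v. The norms are s + 2, the products within the two nonadjacent pairs
    are -s, and a cross product is 1 plus s + 1 times the adjacency. Everything cancels except a
    nonpositive multiple of the number of cross adjacencies. *)
Lemma private_nbrs x y u v r r' : r \in Q -> r' \in Q -> r != r' ->
  x \notin Q -> y \notin Q -> u \notin Q -> v \notin Q ->
  tau x = 1%N -> tau y = 1%N -> tau u = 1%N -> tau v = 1%N ->
  h x r -> h y r -> h u r' -> h v r' -> x != y -> u != v ->
  ~~ h x y -> ~~ h u v -> False.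
Proof.
move=> rQ r'Q rr' xQ yQ uQ vQ tx ty tu tv hx hy hu hv xy uv /negPf nxy /negPf nuv.
have ne z w : h z r -> h w r' -> tau z = 1%N -> z != w.
  move=> hz hw tz; apply: contraNneq rr' => E; move: hw; rewrite -E.
  by rewrite (nbrs1P rQ) // eq_sym.
have hr w : h w r' -> tau w = 1%N -> h w r = false.
  by move=> hw tw; rewrite (nbrs1P r'Q) //; apply/negbTE.
have [xu xv yu yv] : [/\ x != u, x != v, y != u & y != v] by split; apply: ne.
have := @res_quad_pos Q [:: (1, x); (1, y); (-1, u); (-1, v)] cQ.
rewrite /= !inE !negb_or xy xu xv yu yv uv xQ yQ uQ vQ /= => /(_ isT isT isT).
rewrite !(big_cons, big_nil) /res_norm !res_xy //=.
rewrite !(common1 _ rQ hx) // !(common1 _ rQ hy) // !(common1 _ r'Q hu) //.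
rewrite !tx !ty !tu !tv hv hy nxy nuv !hr //.
set H := (X in 0 < X -> _) => Hpos.
suff : H <= 0 by rewrite leNgt Hpos.
have -> : H = - (#|Q|.+1%:Z * 2 * ((h x u)%:Z + (h x v)%:Z + (h y u)%:Z + (h y v)%:Z)).
  by rewrite /H /=; ring.
by rewrite oppr_le0 !mulr_ge0 ?addr_ge0.
Qed.

Lemma sqr_lt_bounds (a b : int) : 0 <= b -> a ^+ 2 < b ^+ 2 -> - b < a /\ a < b.
Proof. by move=> b0 H; split; nia. Qed.

(* Residues of exotic vertices are determined modulo [#|Q| + 1] up to this sign. *)
Definition sgn x : int := if (2 * tau x <= s)%N then 1 else -1.

Definition sres x y : int := sgn x * sgn y * res Q x y.

Lemma sgn_sqr x : sgn x ^+ 2 = 1.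
Proof. by rewrite /sgn; case: ifP. Qed.

Fixpoint sres_quad (L : seq (int * T)) : int :=
  if L is p :: L' then
    p.1 ^+ 2 * res_norm Q p.2 + 2 * p.1 * (\sum_(r <- L') r.1 * sres p.2 r.2)
      + sres_quad L'
  else 0.

Lemma sres_quad_pos (L : seq (int * T)) : uniq (unzip2 L) ->
  all (fun p => p.2 \notin Q) L -> has (fun p => p.1 != 0) L -> 0 < sres_quad L.
Proof.
move=> uL LQ hL.
have := @res_quad_pos Q [seq (sgn p.2 * p.1, p.2) | p <- L] cQ.
rewrite /unzip2 -map_comp -[map _ _]/(unzip2 L) uL all_map has_map.
have -> : has (preim (fun p => (sgn p.2 * p.1, p.2)) (fun p : int * T => p.1 != 0)) L.
  rewrite -(eq_has (a1 := fun p => p.1 != 0)) // => p /=.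
  by rewrite mulf_eq0 /sgn; case: ifP.
move=> /(_ isT LQ isT); congr (0 < _).
elim: L {uL LQ hL} => [//|p L IH] /=.
rewrite IH exprMn sgn_sqr mul1r; congr (_ + _ + _).
rewrite big_map !mulr_sumr; apply: eq_bigr => r _ /=; rewrite /sres; ring.
Qed.

Lemma exotic_bounds x : exotic x ->
  [/\ x \notin Q, (1 < tau x)%N, (tau x < s)%N & 0 < res_norm Q x].
Proof.
move=> /andP[xQ tx]; split=> //; last exact: res_norm_gt0.
by apply: nbrs_lt => //; apply: ltn_trans tx.
Qed.

Lemma res_bounds x y (m : int) : x \notin Q -> y \notin Q -> x != y -> 0 <= m ->
  res_norm Q x * res_norm Q y <= m ^+ 2 -> - m < res Q x y /\ res Q x y < m.
Proof.
move=> xQ yQ xy m0 H; apply: sqr_lt_bounds => //.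
by apply: lt_le_trans H; apply: res_pair.
Qed.

(** Here [tau] is 2 or 3, that is 2 or -2 modulo 5. With signs the product is 4 modulo 5, and only
    -1 lies strictly between -4 and 4. *)
Lemma exotic_res4 x y : s = 4%N -> exotic x -> exotic y -> x != y ->
  [/\ res_norm Q x = 4, res_norm Q y = 4 & sres x y = -1].
Proof.
move=> s4 /exotic_bounds[xQ tx ux _] /exotic_bounds[yQ ty uy _] xy.
have n4 z : (1 < tau z)%N -> (tau z < s)%N -> res_norm Q z = 4.
  by rewrite /res_norm s4; case: (tau z) => [|[|[|[|?]]]].
have [] := @res_bounds x y 4 xQ yQ xy isT; first by rewrite !n4.
rewrite !n4 // /sres /sgn res_xy // s4; move: tx ux ty uy; rewrite s4.
set j := (_ - _); case: (tau x) => [|[|[|[|?]]]] // _ _;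
  by case: (tau y) => [|[|[|[|?]]]] // _ _ /=; split; lia.
Qed.

(** Modulo 6, norm 3 means [tau] = 3; two such vertices would have product 3 modulo 6 and absolute
    value below 3. Two vertices of norm 4 have signed product 4 modulo 6, hence -2. *)
Lemma exotic_res5 x y : s = 5%N -> exotic x -> exotic y -> x != y ->
  [\/ [/\ res_norm Q x = 4, res_norm Q y = 4 & sres x y = -2],
       (res_norm Q x = 4 /\ res_norm Q y = 3)
     | (res_norm Q x = 3 /\ res_norm Q y = 4)].
Proof.
move=> s5 /exotic_bounds[xQ tx ux _] /exotic_bounds[yQ ty uy _] xy.
have n4 z : (1 < tau z)%N -> (tau z < s)%N -> res_norm Q z = if tau z == 3%N then 3 else 4.
  by rewrite /res_norm s5; case: (tau z) => [|[|[|[|[|?]]]]].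
rewrite !n4 //.
have [||] := @res_bounds x y (if (tau x == 3%N) && (tau y == 3%N) then 3 else 4) xQ yQ xy.
- by case: ifP.
- by rewrite !n4 //; case: eqP; case: eqP.
rewrite /sres /sgn res_xy // s5; move: tx ux ty uy; rewrite s5.
set j := (_ - _); case: (tau x) => [|[|[|[|[|?]]]]] // _ _;
  case: (tau y) => [|[|[|[|[|?]]]]] // _ _ /= *;
  first [ by apply: Or31; split; lia | by apply: Or32 | by apply: Or33 | by exfalso; lia ].
Qed.

(** Modulo 7, norm 4 has signed residue 2 and norm 2 has signed residue 3. Two vertices of norm 2
    would need a product equal to 2 modulo 7 with absolute value below 2. *)
Lemma exotic_res6 x y : s = 6%N -> exotic x -> exotic y -> x != y ->
  [\/ [/\ res_norm Q x = 4, res_norm Q y = 4 & sres x y = -3],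
       [/\ res_norm Q x = 4, res_norm Q y = 2 & sres x y = -1]
     | [/\ res_norm Q x = 2, res_norm Q y = 4 & sres x y = -1]].
Proof.
move=> s6 /exotic_bounds[xQ tx ux _] /exotic_bounds[yQ ty uy _] xy.
pose b z := (tau z == 3%N) || (tau z == 4%N).
have n4 z : (1 < tau z)%N -> (tau z < s)%N -> res_norm Q z = if b z then 2 else 4.
  by rewrite /b /res_norm s6; case: (tau z) => [|[|[|[|[|[|?]]]]]].
rewrite !n4 //.
have [||] := @res_bounds x y (if b x && b y then 2 else if b x || b y then 3 else 4) xQ yQ xy.
- by case: ifP => //; case: ifP.
- by rewrite !n4 //; case: (b x); case: (b y).
rewrite /sres /sgn res_xy // s6 /b; move: tx ux ty uy; rewrite s6.
set j := (_ - _); case: (tau x) => [|[|[|[|[|[|?]]]]]] // _ _;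
  case: (tau y) => [|[|[|[|[|[|?]]]]]] // _ _ /= *;
  first [ by apply: Or31; split; lia | by apply: Or32; split; lia
        | by apply: Or33; split; lia | by exfalso; lia ].
Qed.

(** Write the norm as 4 - a b with a + b = s - 3, at least 4. Positivity forces a b = 0, that is
    [tau] equal to 2 or -2 modulo s + 1, unless s = 7 and {a, b} = {1, 3}. In each case the
    congruence of the product contradicts Cauchy-Schwarz. *)
Lemma exotic_unique x y : (6 < s)%N -> exotic x -> exotic y -> x = y.
Proof.
move=> s6 /exotic_bounds[xQ tx ux nx] /exotic_bounds[yQ ty uy ny]; apply/eqP/negPn/negP => xy.
have [a ax] : exists a : nat, tau x = a.+2 by exists (tau x - 2)%N; lia.
have [b bx] : exists b : nat, s = (b + a).+3 by exists (s - tau x).-1; lia.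
have [a' ay] : exists a : nat, tau y = a.+2 by exists (tau y - 2)%N; lia.
have [b' by_] : exists b : nat, s = (b + a').+3 by exists (s - tau y).-1; lia.
have Nx : res_norm Q x = 4 - a%:Z * b%:Z by rewrite /res_norm ax bx; nia.
have Ny : res_norm Q y = 4 - a'%:Z * b'%:Z by rewrite /res_norm ay by_; nia.
have dich (p q : nat) : s = (q + p).+3 -> 0 < 4 - p%:Z * q%:Z ->
  [\/ p = 0%N, q = 0%N | s = 7%N /\ (p = 1%N \/ p = 3%N)].
  move=> E pq; case: p E pq => [|p] E pq; first by apply: Or31.
  case: q E pq => [|q] E pq; first by apply: Or32.
  apply: Or33; case: p E pq => [|[|[|p]]] E pq; try by split; [lia|]; lia.
move: (nx) (ny); rewrite {1}Nx {1}Ny => /(dich _ _ bx) Dx /(dich _ _ by_) Dy.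
(* Modulo c at least 8, neither 4 nor -4 has a representative strictly between -4 and 4. *)
have mult (c j : int) (p q : int) : 8 <= c -> - 4 < c * j + p -> c * j + p < 4 ->
    p = 4 + c * q \/ p = -4 + c * q -> False.
  move=> c8 lo hi [] E; subst p.
    by have [] : j + q <= -1 \/ 0 <= j + q by [lia|]; move=> ?; nia.
  by have [] : j + q <= 0 \/ 1 <= j + q by [lia|]; move=> ?; nia.
have fin (m : int) : 0 <= m -> res_norm Q x * res_norm Q y <= m ^+ 2 ->
    - m < s.+1%:Z * ((h x y)%:Z - (common Q x y)%:Z) + (tau x)%:Z * (tau y)%:Z /\
    s.+1%:Z * ((h x y)%:Z - (common Q x y)%:Z) + (tau x)%:Z * (tau y)%:Z < m.
  by move=> *; rewrite -res_xy //; apply: res_bounds.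
move: fin; set j := (_ - _); rewrite Nx Ny => fin.
have s8 : 8 <= s.+1%:Z by lia.
have [z|[s7 D]] : (a = 0%N \/ b = 0%N) /\ (a' = 0%N \/ b' = 0%N)
   \/ s = 7%N /\ ((a = 1%N \/ a = 3%N) \/ (a' = 1%N \/ a' = 3%N)).
  by case: Dx Dy => ? [] ?; tauto.
  have [||lo hi] := fin 4 => //.
    by case: Dx => [->|->|[? [|] ?]]; case: Dy => [->|->|[? [|] ?]]; lia.
  rewrite ax ay in lo hi.
  case: z => -[za|zb] [za'|zb'].
  - by apply: (mult _ j _ 0 s8 lo hi); left; lia.
  - by apply: (mult _ j _ 2 s8 lo hi); right; lia.
  - by apply: (mult _ j _ 2 s8 lo hi); right; lia.
  - by apply: (mult _ j _ (s.+1%:Z - 4) s8 lo hi); left; nia.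
have fin1 m := fin m; clear fin.
rewrite ax ay in fin1 *.
have Ea : a = 0%N \/ a = 1%N \/ a = 3%N \/ a = 4%N by case: Dx => [?|?|[_ ?]]; lia.
have Ea' : a' = 0%N \/ a' = 1%N \/ a' = 3%N \/ a' = 4%N by case: Dy => [?|?|[_ ?]]; lia.
have [Eb Eb'] : b = (4 - a)%N /\ b' = (4 - a')%N by lia.
rewrite s7 Eb Eb' in fin1.
(* For s = 7 the norm 4 - a (4 - a) is a perfect square, 4 or 1; [m1] is its root. *)
pose m1 (c : nat) : int := if (c == 0%N) || (c == 4%N) then 2 else 1.
have [||] := fin1 (m1 a * m1 a').
- by rewrite /m1; case: ifP; case: ifP.
- by case: Ea => [|[|[|]]] ->; case: Ea' => [|[|[|]]] ->.
move: D; case: Ea => [|[|[|]]] ->; case: Ea' => [|[|[|]]] ->;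
  rewrite /m1 /= => D; lia.
Qed.

(** * Few exotic vertices, and pendant vertices for s = 4 *)

Definition exotics : {set T} := [set x | exotic x].

Lemma exotic_out x : exotic x -> x \notin Q.
Proof. by case/andP. Qed.

(** The signed sum of five exotic vertices would have norm 5 * 4 - 20 = 0. *)
Lemma card_exotics4 : s = 4%N -> (#|exotics| <= 4)%N.
Proof.
move=> s4; rewrite leqNgt; apply/negP => /card_geqP[[|x [|y [|z [|w [|v [|? ?]]]]]] []] //.
move=> U _ /allP; rewrite /= !inE => /and5P[ex ey ez ew /andP[ev _]].
have := @sres_quad_pos [:: (1, x); (1, y); (1, z); (1, w); (1, v)] U.
rewrite /= !exotic_out //= => /(_ isT isT); rewrite !(big_cons, big_nil).
move: U; rewrite /= !inE !negb_or.
move=> /and5P[/and4P[xy xz xw xv] /and3P[yz yw yv] /andP[zw zv] wv _].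
have [-> -> ->] := exotic_res4 s4 ex ey xy.
have [_ -> ->] := exotic_res4 s4 ex ez xz.
have [_ -> ->] := exotic_res4 s4 ex ew xw.
have [_ -> ->] := exotic_res4 s4 ex ev xv.
have [_ _ ->] := exotic_res4 s4 ey ez yz.
have [_ _ ->] := exotic_res4 s4 ey ew yw.
have [_ _ ->] := exotic_res4 s4 ey ev yv.
have [_ _ ->] := exotic_res4 s4 ez ew zw.
have [_ _ ->] := exotic_res4 s4 ez ev zv.
by have [_ _ ->] := exotic_res4 s4 ew ev wv.
Qed.

(** Three vertices of norm 4 with pairwise products -2 would have a signed sum of norm 12 - 12 = 0.
    As two vertices of norm 3 cannot coexist, at most 2 + 1 exotic vertices remain. *)
Lemma exotics5_triple x y z : s = 5%N -> exotic x -> exotic y -> exotic z ->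
  x != y -> x != z -> y != z ->
  res_norm Q x = 3 \/ res_norm Q y = 3 \/ res_norm Q z = 3.
Proof.
move=> s5 ex ey ez xy xz yz.
have := @sres_quad_pos [:: (1, x); (1, y); (1, z)].
rewrite /= !inE !negb_or xy xz yz !exotic_out //= => /(_ isT isT isT).
rewrite !(big_cons, big_nil).
case: (exotic_res5 s5 ex ey xy) => [[nx ny ->]|[? ?]|[? ?]]; [|tauto|tauto].
case: (exotic_res5 s5 ex ez xz) => [[_ nz ->]|[? ?]|[? ?]]; [|tauto|tauto].
case: (exotic_res5 s5 ey ez yz) => [[_ _ ->]|[? ?]|[? ?]]; [|tauto|tauto].
by rewrite nx ny nz.
Qed.

Lemma card_exotics5 : s = 5%N -> (#|exotics| <= 3)%N.
Proof.
move=> s5; rewrite leqNgt; apply/negP => /card_geqP[[|x [|y [|z [|w [|? ?]]]]] []] //.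
move=> + _ /allP; rewrite /= !inE !negb_or.
move=> /and4P[/and3P[xy xz xw] /andP[yz yw] zw _] /and5P[ex ey ez ew _].
have n3 a b : exotic a -> exotic b -> a != b -> res_norm Q a = 3 -> res_norm Q b = 3 -> False.
  by move=> ea eb ab na nb; case: (exotic_res5 s5 ea eb ab) => [[]|[]|[]]; rewrite ?na ?nb.
have := exotics5_triple s5 ex ey ez xy xz yz.
have := exotics5_triple s5 ex ey ew xy xw yw.
have := exotics5_triple s5 ex ez ew xz xw zw.
have := exotics5_triple s5 ey ez ew yz yw zw.
by move: (n3 x y) (n3 x z) (n3 x w) (n3 y z) (n3 y w) (n3 z w); tauto.
Qed.

(** At most one norm is 2, so the signed sum of three exotic vertices would have norm 12 - 18 or 10
    - 2 * (3 + 1 + 1) = 0. *)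
Lemma card_exotics6 : s = 6%N -> (#|exotics| <= 2)%N.
Proof.
move=> s6; rewrite leqNgt; apply/negP => /card_geqP[[|x [|y [|z [|? ?]]]] []] //.
move=> U _ /allP; rewrite /= !inE => /and4P[ex ey ez _].
have := @sres_quad_pos [:: (1, x); (1, y); (1, z)] U.
rewrite /= !exotic_out //= => /(_ isT isT); rewrite !(big_cons, big_nil).
move: U; rewrite /= !inE !negb_or => /and3P[/andP[xy xz] yz _].
case: (exotic_res6 s6 ex ey xy) => [] [n1 n2 ->];
  case: (exotic_res6 s6 ex ez xz) => [] [n3 n4 ->]; rewrite n1 ?n2 ?n4 //;
  case: (exotic_res6 s6 ey ez yz) => [] [n5 n6 ->] //; lia.
Qed.

(** Without a common neighbour the product is at least [tau x * tau y], hence at least 4, whereas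
    both norms are at most 4. *)
Lemma exotics_common_gt0 x y : exotic x -> exotic y -> x != y -> (0 < common Q x y)%N.
Proof.
move=> /exotic_bounds[xQ tx ux nx] /exotic_bounds[yQ ty uy ny] xy.
rewrite lt0n; apply/eqP => c0.
have n4 z : (1 < tau z)%N -> (tau z < s)%N -> res_norm Q z <= 4.
  by rewrite /res_norm => ? ?; nia.
have [||_] := @res_bounds x y 4 xQ yQ xy => //.
  by apply: (@ler_pM _ _ 4 _ 4); rewrite ?n4 // ltW.
rewrite res_xy // c0; move: tx ty; case: (h x y); nia.
Qed.

Lemma sres_sym x y : sres x y = sres y x.
Proof. by rewrite /sres res_sym [sgn y * _]mulrC. Qed.

(** The norms multiply to 24 < 25, and 2 and -3 are the values congruent to 2 modulo 5 strictly
    between -5 and 5. *)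
Lemma pendant_res4 x v : s = 4%N -> exotic x -> v \notin Q -> tau v = 1%N ->
  res_norm Q v = 6 /\ (sres x v = 2 \/ sres x v = -3).
Proof.
move=> s4 /exotic_bounds[xQ tx ux nx] vQ tv.
have xv : x != v by apply: contraTneq tx => ->; rewrite tv.
have := @res_bounds x v 5 xQ vQ xv isT.
have -> : res_norm Q v = 6 by rewrite /res_norm s4 tv.
rewrite /sres /sgn res_xy // s4 tv /res_norm s4; move: tx ux; rewrite s4.
set j := ((h x v)%:Z - _); case: (tau x) => [|[|[|[|?]]]] // _ _ /= [] //; lia.
Qed.

(** Exactly one product is -3. Two of them, at a and b, give a + b + v the norm 14 - 2 * (1 + 3 + 3)
    = 0; none gives x + y + z - v the norm 18 - 2 * (3 + 6) = 0 (all up to sign). *)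
Lemma pendant_triple4 x y z v : s = 4%N -> exotic x -> exotic y -> exotic z ->
  v \notin Q -> tau v = 1%N -> x != y -> x != z -> y != z ->
  [\/ [/\ sres x v = -3, sres y v = 2 & sres z v = 2],
      [/\ sres x v = 2, sres y v = -3 & sres z v = 2]
    | [/\ sres x v = 2, sres y v = 2 & sres z v = -3]].
Proof.
move=> s4 ex ey ez vQ tv xy xz yz.
have ne t : exotic t -> t != v by move=> /andP[_]; apply: contraTneq => ->; rewrite tv.
have [xv yv zv] := And3 (ne _ ex) (ne _ ey) (ne _ ez).
have pair a b : exotic a -> exotic b -> a != b -> sres a v = -3 -> sres b v = -3 -> False.
  move=> ea eb ab av bv; have [nv _] := pendant_res4 s4 ea vQ tv.
  have := @sres_quad_pos [:: (1, a); (1, b); (1, v)].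
  rewrite /= !inE !negb_or ab !ne // vQ !exotic_out //= => /(_ isT isT isT).
  rewrite !(big_cons, big_nil) /= av bv nv.
  by have [-> -> ->] := exotic_res4 s4 ea eb ab.
have triple : [/\ sres x v = 2, sres y v = 2 & sres z v = 2] -> False.
  move=> [sx sy sz]; have [nv _] := pendant_res4 s4 ex vQ tv.
  have := @sres_quad_pos [:: (1, x); (1, y); (1, z); (-1, v)].
  rewrite /= !inE !negb_or xy xz yz xv yv zv vQ !exotic_out //= => /(_ isT isT isT).
  rewrite !(big_cons, big_nil) /= sx sy sz nv.
  have [-> -> ->] := exotic_res4 s4 ex ey xy.
  have [_ -> ->] := exotic_res4 s4 ex ez xz.
  by have [_ _ ->] := exotic_res4 s4 ey ez yz.
have [_ cx] := pendant_res4 s4 ex vQ tv.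
have [_ cy] := pendant_res4 s4 ey vQ tv.
have [_ cz] := pendant_res4 s4 ez vQ tv.
move: (pair x y) (pair x z) (pair y z) triple => pxy pxz pyz tr.
case: cx => cx; case: cy => cy; case: cz => cz.
- by case: tr.
- by apply: Or33.
- by apply: Or32.
- by case: pyz.
- by apply: Or31.
- by case: pxz.
- by case: pxy.
- by case: pxy.
Qed.

Lemma pendant_res44 v w : s = 4%N -> v \notin Q -> w \notin Q -> v != w ->
  tau v = 1%N -> tau w = 1%N -> sres v w = 1 \/ sres v w = -4.
Proof.
move=> s4 vQ wQ vw tv tw.
have := @res_bounds v w 6 vQ wQ vw isT.
rewrite /sres /sgn res_xy // s4 tv tw /res_norm s4 tv tw /=.
set j := ((h v w)%:Z - _) => -[] //; lia.
Qed.

Lemma five_outside x y z v w : s = 4%N -> exotic x -> exotic y -> exotic z ->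
  v \notin Q -> w \notin Q -> (0 < tau v)%N -> (0 < tau w)%N ->
  uniq [:: x; y; z; v; w] -> False.
Proof.
move=> s4 ex ey ez vQ wQ; rewrite /= !inE !negb_or => tv tw.
move=> /and5P[/and4P[xy xz xv xw] /and3P[yz yv yw] /andP[zv zw] vw _].
(* Among four exotic vertices every triple would contain exactly one product -3 with [b]; each
   vertex lies in three of the four triples, and 4 is not a multiple of 3. *)
have mixed a b : exotic a -> a != x -> a != y -> a != z -> b \notin Q -> tau b = 1%N -> False.
  move=> ea ax ay az bQ tb.
  have cnt c d f : exotic c -> exotic d -> exotic f -> c != d -> c != f -> d != f ->
      ((sres c b == (-3)%R) + (sres d b == (-3)%R) + (sres f b == (-3)%R) = 1)%N.
    move=> ec ed ef cd cf df.
    by case: (pendant_triple4 s4 ec ed ef bQ tb cd cf df) => -[-> -> ->].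
  move: (cnt x y z ex ey ez xy xz yz) (cnt a y z ea ey ez ay az yz).
  move: (cnt a x z ea ex ez ax az xz) (cnt a x y ea ex ey ax ay xy).
  by do 4! case: (_ == _).
have [tv1|tv2] := eqVneq (tau v) 1%N; have [tw1|tw2] := eqVneq (tau w) 1%N.
- have [nv _] := pendant_res4 s4 ex vQ tv1.
  have [nw _] := pendant_res4 s4 ex wQ tw1.
  have q (a b c d e : int) : a != 0 -> 0 < sres_quad [:: (a, v); (b, w); (c, x); (d, y); (e, z)].
    move=> a0; apply: sres_quad_pos; rewrite /= ?a0 // ?vQ ?wQ ?exotic_out //.
    rewrite !inE !negb_or xy xz yz vw (eq_sym v) xv (eq_sym v) yv (eq_sym v) zv.
    by rewrite (eq_sym w) xw (eq_sym w) yw (eq_sym w) zw.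
  have {}q a b c d e : a != 0 -> 0 < a ^+ 2 * 6 + 2 * a * (b * sres v w + c * sres x v +
     d * sres y v + e * sres z v) + b ^+ 2 * 6 + 2 * b * (c * sres x w + d * sres y w + e * sres z w)
     + 4 * c ^+ 2 + 4 * d ^+ 2 + 4 * e ^+ 2 - 2 * c * d - 2 * c * e - 2 * d * e.
    move=> a0; have := q a b c d e a0; rewrite /= !(big_cons, big_nil) /= nv nw.
    have [-> -> ->] := exotic_res4 s4 ex ey xy.
    have [_ -> ->] := exotic_res4 s4 ex ez xz.
    have [_ _ ->] := exotic_res4 s4 ey ez yz.
    rewrite !(sres_sym v x, sres_sym v y, sres_sym v z, sres_sym w x, sres_sym w y, sres_sym w z).
    by congr (0 < _); ring.
  (* Eighteen cases: two values of [sres v w], and for each of [v] and [w] the position of its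
     product -3. Each has a small vector on which the form is not positive. *)
  have [D|D] := pendant_res44 s4 vQ wQ vw tv1 tw1;
    have := pendant_triple4 s4 ex ey ez wQ tw1 xy xz yz;
    have := pendant_triple4 s4 ex ey ez vQ tv1 xy xz yz;
    case=> -[ax ay az]; case=> -[bx bY bz]; move: q; rewrite D ax ay az bx bY bz => q.
  + by move: (q 1 1 1 (-1) (-1) isT); clear; vm_compute.
  + by move: (q 1 (-1) 1 (-1) 0 isT); clear; vm_compute.
  + by move: (q 1 (-1) 1 0 (-1) isT); clear; vm_compute.
  + by move: (q 1 (-1) (-1) 1 0 isT); clear; vm_compute.
  + by move: (q 1 1 (-1) 1 (-1) isT); clear; vm_compute.
  + by move: (q 1 (-1) 0 1 (-1) isT); clear; vm_compute.
  + by move: (q 1 (-1) (-1) 0 1 isT); clear; vm_compute.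
  + by move: (q 1 (-1) 0 (-1) 1 isT); clear; vm_compute.
  + by move: (q 1 1 (-1) (-1) 1 isT); clear; vm_compute.
  + by move: (q 1 1 1 (-1) (-1) isT); clear; vm_compute.
  + by move: (q 1 1 0 0 (-1) isT); clear; vm_compute.
  + by move: (q 1 1 0 (-1) 0 isT); clear; vm_compute.
  + by move: (q 1 1 0 0 (-1) isT); clear; vm_compute.
  + by move: (q 1 1 (-1) 1 (-1) isT); clear; vm_compute.
  + by move: (q 1 1 (-1) 0 0 isT); clear; vm_compute.
  + by move: (q 1 1 0 (-1) 0 isT); clear; vm_compute.
  + by move: (q 1 1 (-1) 0 0 isT); clear; vm_compute.
  + by move: (q 1 1 (-1) (-1) 1 isT); clear; vm_compute.
- have ew : exotic w by rewrite /exotic wQ ltn_neqAle eq_sym tw2.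
  by apply: (mixed w v) => //; rewrite eq_sym.
- have ev : exotic v by rewrite /exotic vQ ltn_neqAle eq_sym tv2.
  by apply: (mixed v w) => //; rewrite eq_sym.
- have ew : exotic w by rewrite /exotic wQ ltn_neqAle eq_sym tw2.
  have ev : exotic v by rewrite /exotic vQ ltn_neqAle eq_sym tv2.
  have := card_exotics4 s4; rewrite leqNgt => /negP; apply; apply/card_geqP.
  exists [:: x; y; z; v; w]; split=> //.
    by rewrite /= !inE !negb_or xy xz xv xw yz yv yw zv zw vw.
  by apply/allP; rewrite /= !inE ex ey ez ev ew.
Qed.

(** If they were adjacent, the product -1 would force three common neighbours in [Q], hence a clique
    of size 5. *)
Lemma exotic3_nadj x y : s = 4%N -> exotic x -> exotic y -> tau x = 3%N -> tau y = 3%N ->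
  ~~ h x y.
Proof.
move=> s4 ex ey tx ty; apply/negP => hxy.
have xy : x != y by apply: contraTneq hxy => ->; rewrite h_irr.
have [_ _] := exotic_res4 s4 ex ey xy.
rewrite /sres /sgn res_xy // tx ty s4 hxy /= => E.
have := @common_lt x y (exotic_out ex) (exotic_out ey) hxy.
by rewrite s4; lia.
Qed.

Definition private r : {set T} := [set x | [&& x \notin Q, h x r & tau x == 1%N]].

Lemma clique_private_card r : r \in Q -> clique (private r) -> (#|private r| < s)%N.
Proof.
move=> rQ cp; have <- : #|r |: private r| = #|private r|.+1.
  by rewrite cardsU1 inE rQ.
apply: (Qmax (q := r)) => //; first by rewrite !inE eqxx.
by apply: clique_setU1 => // y; rewrite inE h_sym => /and3P[].
Qed.

Lemma nonclique_ex (K : {set T}) :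
  (clique K) \/ (exists x y, [/\ x \in K, y \in K, x != y & ~~ h x y]).
Proof.
case: (boolP [forall x in K, forall y in K, (x != y) ==> h x y]) => [/forall_inP H|].
  by left=> x y xK yK; apply/implyP; move: y yK; apply/forall_inP/H.
rewrite negb_forall_in => /exists_inP[x xK]; rewrite negb_forall_in => /exists_inP[y yK].
by rewrite negb_imply => /andP[xy nxy]; right; exists x, y.
Qed.

Lemma private_clique r r' : r \in Q -> r' \in Q -> r != r' ->
  clique (private r) \/ clique (private r').
Proof.
move=> rQ r'Q rr'; have [|[x [y [+ + xy nxy]]]] := nonclique_ex (private r); first by left.
rewrite !inE => /and3P[xQ hx /eqP tx] /and3P[yQ hy /eqP ty].
have [|[u [v [+ + uv nuv]]]] := nonclique_ex (private r'); first by right.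
rewrite !inE => /and3P[uQ hu /eqP tu] /and3P[vQ hv /eqP tv].
by case: (@private_nbrs x y u v r r').
Qed.

Definition h_closed : Prop := forall r y, r \in Q -> h r y -> y \in Q.

(** * Degree counting when [h] is the collinearity graph of a k-regular graph *)

Variables (e : rel T) (k : nat).
Hypothesis e_sym : forall x y, e x y = e y x.
Hypothesis e_reg : forall x, #|[set y | e x y]| = k.
Hypothesis e_girth : forall x y l l', x != y ->
  e l x -> e l y -> e l' x -> e l' y -> l = l'.
Hypothesis hE : forall x y, h x y = (x != y) && [exists l, e l x && e l y].

Local Notation d := (k * k.-1)%N.

Lemma hP x y : reflect (x != y /\ exists l, e l x /\ e l y) (h x y).
Proof.
rewrite hE; apply: (iffP andP) => -[xy].
  by move=> /existsP[l /andP[lx ly]]; split=> //; exists l.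
by move=> [l [lx ly]]; split=> //; apply/existsP; exists l; rewrite lx.
Qed.

Lemma on_line l x y : e l x -> e l y -> x != y -> h x y.
Proof. by move=> lx ly xy; apply/hP; split=> //; exists l. Qed.

Lemma h_count x y : x != y -> (h x y : nat) = (\sum_l e x l * e l y)%N.
Proof.
move=> xy; case: hP => [[_ [l [lx ly]]]|H].
  rewrite (bigD1 l) //= e_sym lx ly big1 // => l' ll'.
  rewrite e_sym; case: (boolP (e l' x)) => // l'x; case: (boolP (e l' y)) => // l'y.
  by rewrite (e_girth xy l'x l'y lx ly) eqxx in ll'.
rewrite big1 // => l _; rewrite e_sym.
case: (boolP (e l x)) => // lx; case: (boolP (e l y)) => // ly.
by case: H; split=> //; exists l.
Qed.

Lemma h_reg x : #|[set y | h x y]| = d.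
Proof.
have cardE (P : pred T) : #|[set y | P y]| = (\sum_y P y)%N.
  by rewrite -sum1_card big_mkcond; apply: eq_bigr => y _; rewrite inE; case: (P y).
rewrite cardE (bigD1 x) //= h_irr add0n.
transitivity (\sum_(y | y != x) \sum_l e x l * e l y)%N.
  by apply: eq_bigr => y yx; rewrite h_count // eq_sym.
rewrite exchange_big /=.
transitivity (\sum_l e x l * k.-1)%N; last first.
  by rewrite -big_distrl /= -(e_reg x) cardE.
apply: eq_bigr => l _; case: (boolP (e x l)) => xl; rewrite ?mul0n ?mul1n.
  rewrite -(e_reg l) cardE [X in X.-1](bigD1 x) //= (e_sym l) xl.
  by apply: eq_bigr => y _; rewrite mul1n.
by rewrite big1 // => y _.
Qed.

Lemma card_inside r : r \in Q -> #|[set y in Q | h r y]| = s.-1.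
Proof.
move=> rQ; rewrite (cardsD1 r Q) rQ /=; apply: eq_card => y; rewrite !inE.
have [->|yr] := eqVneq y r; first by rewrite h_irr andbF.
by case: (boolP (y \in Q)) => //= yQ; apply/cQ; rewrite // eq_sym.
Qed.

Lemma card_outside r : r \in Q -> (s.-1 + #|[set y | (y \notin Q) && h r y]|)%N = d.
Proof.
move=> rQ; rewrite -(card_inside rQ) -(h_reg r) -(cardsID Q [set y | h r y]).
by congr (_ + _)%N; apply: eq_card => y; rewrite !inE // andbC.
Qed.

Lemma outside_gt0 r y : r \in Q -> y \notin Q -> h r y -> (0 < tau y)%N.
Proof. by move=> rQ yQ hy; rewrite nbrsE; apply/card_gt0P; exists r; rewrite inE rQ h_sym. Qed.

Lemma degree_split r : r \in Q ->
  d = (s.-1 + (#|private r| + #|[set x in exotics | h x r]|))%N.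
Proof.
move=> rQ; rewrite -(card_outside rQ); congr (_ + _)%N.
set A := [set y | _]; rewrite -(cardsID [set x | tau x == 1%N] A).
congr (_ + _)%N; apply: eq_card => y; rewrite !inE (h_sym r).
  by rewrite -andbA.
rewrite /exotic; case: (boolP (y \in Q)) => yQ /=; first by rewrite !andbF.
have [hy|hy] := boolP (h y r); rewrite ?andbF //= !andbT.
have := outside_gt0 rQ yQ; rewrite h_sym hy => /(_ isT).
by case: (tau y) => [|[|?]].
Qed.

Lemma degree_le r : r \in Q -> (#|private r| < s)%N ->
  (d <= s.-1 + (s.-1 + #|exotics|))%N.
Proof.
move=> rQ pr; rewrite (degree_split rQ) leq_add2l leq_add //; first by lia.
by apply: subset_leq_card; apply/subsetP => x; rewrite inE => /andP[].
Qed.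

Lemma closed_of_degree : (d < s)%N -> h_closed.
Proof.
move=> ds r y rQ hry; apply: contraT => yQ.
have := card_outside rQ; have : (0 < #|[set y | (y \notin Q) && h r y]|)%N.
  by apply/card_gt0P; exists y; rewrite inE yQ.
have : (0 < s)%N by apply/card_gt0P; exists r.
by move: ds; lia.
Qed.

Lemma one_outside r : d = s -> r \in Q ->
  exists2 w, w \notin Q /\ h r w & forall y, h r y -> y \notin Q -> y = w.
Proof.
move=> ds rQ; have s0 : (0 < s)%N by apply/card_gt0P; exists r.
have /eqP/cards1P[w E] : #|[set y | (y \notin Q) && h r y]| = 1%N.
  by have := card_outside rQ; rewrite ds; lia.
have : w \in [set w] by rewrite inE.
rewrite -E inE => /andP[wQ hw]; exists w => // y hy yQ.
by apply/set1P; rewrite -E inE yQ.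
Qed.

(** The outside neighbour w of r misses some r' in [Q], whose outside neighbour w' is another exotic
    vertex. Then w and w' share a neighbour in [Q], which has two outside neighbours. *)
Lemma one_outside_exotic : d = s -> (0 < s)%N ->
  (forall r w, r \in Q -> w \notin Q -> h r w -> exotic w) -> False.
Proof.
move=> ds /card_gt0P[r rQ] ex.
have [w [wQ hw] uw] := one_outside ds rQ.
have ew := ex _ _ rQ wQ hw; have [_ _ ws _] := exotic_bounds ew.
have [r' r'Q nhr'] : exists2 r', r' \in Q & ~~ h w r'.
  apply/exists_inP; apply: contraTT ws; rewrite negb_exists_in => /forall_inP H.
  rewrite -leqNgt nbrsE; apply: subset_leq_card; apply/subsetP => q qQ.
  by rewrite inE qQ /=; have := H _ qQ; rewrite negbK.
have [w' [w'Q hw'] uw'] := one_outside ds r'Q.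
have ew' := ex _ _ r'Q w'Q hw'.
have ww' : w != w' by apply: contraNneq nhr' => ->; rewrite h_sym.
have := exotics_common_gt0 ew ew' ww'; rewrite commonE => /card_gt0P[q].
rewrite inE => /and3P[qQ h1 h2].
have [z _ uz] := one_outside ds qQ.
by case/eqP: ww'; rewrite (uz w) 1?h_sym // (uz w') // h_sym.
Qed.

Hypothesis k_ge3 : (2 < k)%N.
Hypothesis Q_gt0 : (0 < s)%N.

Lemma exists_notin (A B : {set T}) : (#|B| < #|A|)%N -> exists2 x, x \in A & x \notin B.
Proof.
move=> AB; apply/subsetPn; apply: contraTN AB => /subset_leq_card.
by rewrite -leqNgt.
Qed.

Lemma line_clique l : clique [set x | e l x].
Proof. by move=> x y; rewrite !inE; apply: on_line. Qed.

Lemma third_point l x y : exists z, [/\ e l z, z != x & z != y].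
Proof.
have [|z] := @exists_notin [set z | e l z] [set x; y].
  by rewrite e_reg cards2; case: (x != y); lia.
by rewrite !inE negb_or => lz /andP[zx zy]; exists z.
Qed.

Lemma k_le_s : (k <= s)%N.
Proof.
have [q qQ] := card_gt0P Q_gt0.
have [l [lq _ _]] := third_point q q q.
rewrite -(e_reg l); apply: (Qmax (q := q)) => //; first by rewrite inE e_sym.
exact: line_clique.
Qed.

Lemma nbrs_gt1 x q q' : q \in Q -> q' \in Q -> q != q' -> h x q -> h x q' -> (1 < tau x)%N.
Proof.
move=> qQ q'Q qq' hq hq'; rewrite nbrsE; apply: (@leq_trans #|[set q; q']|).
  by rewrite cards2 qq'.
by apply: subset_leq_card; apply/subsetP => z /set2P[] ->; rewrite inE ?qQ ?q'Q.
Qed.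

Lemma outside_line_exotic l x q q' : q \in Q -> q' \in Q -> q != q' ->
  e l q -> e l q' -> e l x -> x \notin Q -> exotic x.
Proof.
move=> qQ q'Q qq' lq lq' lx xQ; rewrite /exotic xQ /=.
have ne z : z \in Q -> x != z by apply: contraTneq => <-.
by apply: (@nbrs_gt1 x q q') => //; apply: (on_line lx) => //; apply: ne.
Qed.

(** The line joining r to its only outside neighbour w has a third point; it must lie in [Q], so w
    is exotic. *)
Lemma degree_neq : d = s -> False.
Proof.
move=> ds; apply: (one_outside_exotic ds) => // r w rQ wQ /[dup] hrw /hP[rw [l [lr lw]]].
have [p [lp pr pw]] := third_point l r w.
have [w' _ uw] := one_outside ds rQ.
apply: (@outside_line_exotic l w r p) => //; last by rewrite eq_sym.
apply: contraNT pw => pQ; rewrite (uw w) // (uw p) //.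
by apply: (on_line lr) => //; rewrite eq_sym.
Qed.

Lemma few_exotics_closed : (k < s)%N -> (#|exotics| <= 1)%N -> h_closed.
Proof.
move=> ks E1.
(* A line with two points in [Q] that is not contained in [Q] carries an exotic vertex. Two distinct
   lines through [q] cannot both carry the only one. *)
have [l lQ] : exists l, forall x, e l x -> x \in Q.
  have [q qQ] := card_gt0P Q_gt0.
  have full q' l : q' \in Q -> q != q' -> e l q -> e l q' ->
      (forall x, e l x -> x \in Q) \/ exists2 x, e l x & exotic x.
    move=> q'Q qq' lq lq'; case: (boolP [exists x, e l x && (x \notin Q)]).
      move=> /existsP[x /andP[lx xQ]]; right; exists x => //.
      exact: (outside_line_exotic qQ q'Q qq' lq lq').
    rewrite negb_exists => /forallP H; left=> x lx; apply: contraT => xQ.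
    by have := H x; rewrite lx xQ.
  have [|q' q'Q] := @exists_notin Q [set q]; first by rewrite cards1; lia.
  rewrite inE eq_sym => qq'.
  have [_ [l1 [l1q l1q']]] := hP _ _ (cQ qQ q'Q qq').
  have [|[x l1x ex]] := full q' l1 q'Q qq' l1q l1q'; first by exists l1.
  have [|q2 q2Q] := @exists_notin Q [set z | e l1 z]; first by rewrite e_reg.
  rewrite inE => l1q2; have qq2 : q != q2 by apply: contraNneq l1q2 => <-.
  have [_ [l2 [l2q l2q2]]] := hP _ _ (cQ qQ q2Q qq2).
  have [|[y l2y ey]] := full q2 l2 q2Q qq2 l2q l2q2; first by exists l2.
  have xy : x = y.
    by apply/(card_le1_eqP E1); rewrite inE.
  have qx : q != x by apply: contraTneq qQ => ->; apply: exotic_out.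
  by rewrite (e_girth qx l1q l1x l2q) ?l2q2 // xy in l1q2.
have [|r rQ] := @exists_notin Q [set z | e l z]; first by rewrite e_reg.
rewrite inE => lr.
(* The k points of [l] are joined to [r] by k distinct lines. If [m] missed [l], these would fit
   among the k - 1 other lines through [r]. *)
have meet m : e m r -> exists2 p, e l p & e m p.
  move=> mr; apply/exists_inP; apply: contraT; rewrite negb_exists_in => /forall_inP H.
  pose line p := odflt r [pick l' | e l' r && e l' p].
  have lineP p : e l p -> e (line p) r /\ e (line p) p.
    move=> lp; have rp : r != p by apply: contraNneq lr => ->.
    have [_ [l' [l'r l'p]]] := hP _ _ (cQ rQ (lQ _ lp) rp).
    rewrite /line; case: pickP => [l2 /andP[]//|/(_ l')].
    by rewrite l'r l'p.
  have : (#|line @: [set p | e l p]| <= #|[set l' | e r l'] :\ m|)%N.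
    apply: subset_leq_card; apply/subsetP => l' /imsetP[p]; rewrite inE => lp ->.
    have [a b] := lineP _ lp; rewrite !inE e_sym a andbT.
    by apply: contraTneq b => ->; apply: H.
  rewrite card_in_imset; last first.
    move=> p p'; rewrite !inE => lp lp' E; apply/eqP; apply: contraT => pp'.
    have [a b] := lineP _ lp; have [_ b'] := lineP _ lp'; rewrite -E in b'.
    by rewrite (e_girth pp' lp lp' b b') a in lr.
  have := cardsD1 m [set l' | e r l']; rewrite !e_reg inE e_sym mr.
  by move: k_ge3; lia.
have : (#|[set y | (y \notin Q) && h r y]| <= 1)%N.
  apply: leq_trans E1; apply: subset_leq_card; apply/subsetP => y.
  rewrite !inE => /andP[yQ /hP[ry [m [mr my]]]].
  have [p lp mp] := meet m mr.
  apply: (@outside_line_exotic m y r p) => //; first exact: lQ.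
  by apply: contraNneq lr => ->.
have := card_outside rQ; have := degree_neq; have := @closed_of_degree.
move=> cl ne dE o1; case: (ltnP d s) => [/cl //|sd].
by case: ne; move: Q_gt0; lia.
Qed.

Lemma closed_ge4 : (3 < k)%N -> h_closed.
Proof.
move=> k4; have ks := k_le_s.
have [r0 r0P] : exists r0, forall r, r \in Q -> r != r0 -> (#|private r| < s)%N.
  case: (boolP [forall r in Q, #|private r| < s]%N) => [/forall_inP H|].
    by have [q qQ] := card_gt0P Q_gt0; exists q => r rQ _; apply: H.
  rewrite negb_forall_in => /exists_inP[r0 r0Q nr0]; exists r0 => r rQ rr0.
  have [] := private_clique rQ r0Q rr0; first exact: clique_private_card.
  by move=> /(clique_private_card r0Q); rewrite (negPf nr0).
have [|r rQ] := @exists_notin Q [set r0]; first by rewrite cards1; lia.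
rewrite inE => rr0; have dle := degree_le rQ (r0P _ rQ rr0).
have k12 : (12 <= d)%N by nia.
have k20 : k = 4%N \/ (20 <= d)%N by nia.
have c4 := card_exotics4; have c5 := card_exotics5; have c6 := card_exotics6.
have [s7|s6] := ltnP 6 s.
  have E1 : (#|exotics| <= 1)%N.
    by apply/card_le1_eqP => x y; rewrite !inE => ex ey; apply: exotic_unique.
  by apply: few_exotics_closed => //; nia.
(* For s = 4, 5, 6 the degree is at most 6 + 4, 8 + 3, 10 + 2, against at least 12. *)
have E6 : s = 6%N /\ d = 12%N.
  have [s4|[s5|s6']] : s = 4%N \/ s = 5%N \/ s = 6%N by lia.
  - by have := c4 s4; lia.
  - by have := c5 s5; lia.
  - by have := c6 s6'; lia.
case: E6 => s6' d12; have {c4 c5}c6 := c6 s6'.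
(* The degree bound is attained, so every exotic vertex is adjacent to all of [Q] but possibly
   [r0]. *)
have adj x q : exotic x -> q \in Q -> q != r0 -> h x q.
  move=> ex qQ qr0; have := degree_split qQ; have := r0P _ qQ qr0.
  have : [set x in exotics | h x q] \subset exotics by apply/subsetP => y; rewrite inE => /andP[].
  move=> sub ?; have := subset_leq_card sub => ? ?.
  have : exotics \subset [set x in exotics | h x q].
    rewrite -(geq_leqif (subset_leqif_card sub)); lia.
  by move=> /subsetP/(_ x); rewrite !inE ex => /(_ isT).
have /card_geqP[[|x [|y [|? ?]]] []] // : (2 <= #|exotics|)%N by lia.
rewrite /= !inE andbT => xy _ /allP; rewrite /= !inE => /and3P[ex ey _].
have [xQ tx ux _] := exotic_bounds ex; have [yQ ty uy _] := exotic_bounds ey.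
have c : (5 <= common Q x y)%N.
  rewrite commonE; apply: (@leq_trans #|Q :\ r0|).
    by have := cardsD1 r0 Q; rewrite s6'; case: (r0 \in Q) => /=; lia.
  apply: subset_leq_card; apply/subsetP => q; rewrite !inE => /andP[qr0 qQ].
  by rewrite qQ !adj.
have cx := common_le x y; have cy := common_le_r x y.
have [tx5 ty5 c5] : [/\ tau x = 5%N, tau y = 5%N & common Q x y = 5%N].
  by split; lia.
(* Adjacent, they would extend five common neighbours to a clique of size 7; otherwise the product
   is 25 - 35 = -10. *)
have [|] := boolP (h x y) => hxy.
  by have := common_lt xQ yQ hxy; rewrite c5 s6' => /(_ isT).
have [||] := @res_bounds x y 4 xQ yQ xy => //.
  by rewrite /res_norm s6' tx5 ty5.
by rewrite res_xy // s6' tx5 ty5 c5 (negPf hxy).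
Qed.

Lemma size_le_card (L : seq T) (A : {set T}) : uniq L -> all (mem A) L ->
  (size L <= #|A|)%N.
Proof.
move=> uL /allP sub; rewrite cardE; apply: uniq_leq_size => // x xL.
by rewrite mem_enum; apply: sub.
Qed.

Lemma mem_enumeration (L : seq T) (A : {set T}) : uniq L -> all (mem A) L ->
  (#|A| <= size L)%N -> forall x, x \in A -> x \in L.
Proof.
move=> uL sub AL x xA; apply: contraT => xL.
have := @size_le_card (x :: L) A; rewrite /= xL uL sub /= xA /= => /(_ isT isT).
by rewrite ltnNge AL.
Qed.

(** * The cubic case: excluding maximum cliques of sizes 3, 4 and 5 *)

Section Cubic.

Hypothesis k3 : k = 3%N.

Lemma line_mem l x y z t : e l x -> e l y -> e l z -> uniq [:: x; y; z] -> e l t ->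
  t \in [:: x; y; z].
Proof.
move=> lx ly lz u lt; apply: (@mem_enumeration _ [set t | e l t]) => //.
- by rewrite /= !inE lx ly lz.
- by rewrite e_reg k3.
- by rewrite inE.
Qed.

(** They have exactly one common neighbour in [Q], so the product is 4 * (1 - 1) + 2 * 2 = 4, too
    large for two norms 4. *)
Lemma adjacent_exotics3 x y : s = 3%N -> exotic x -> exotic y -> h x y -> False.
Proof.
move=> s3 ex ey hxy.
have [xQ tx ux _] := exotic_bounds ex; have [yQ ty uy _] := exotic_bounds ey.
have [tx2 ty2] : tau x = 2%N /\ tau y = 2%N by lia.
have xy : x != y by apply: contraTneq hxy => ->; rewrite h_irr.
have c0 := exotics_common_gt0 ex ey xy.
have c1 := common_lt xQ yQ hxy c0.
have [||] := @res_bounds x y 4 xQ yQ xy => //.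
  by rewrite /res_norm s3 tx2 ty2.
rewrite res_xy // s3 tx2 ty2 hxy.
by have -> : common Q x y = 1%N by lia.
Qed.

Lemma no_quad_clique a b c i : s = 3%N -> i \in Q -> uniq [:: i; a; b; c] ->
  h i a -> h i b -> h i c -> h a b -> h a c -> h b c -> False.
Proof.
move=> s3 iQ; rewrite /= !inE !negb_or => /and4P[/and3P[ia ib ic] /andP[ab ac] bc _].
move=> hia hib hic hab hac hbc.
have c1 : clique [set c] by move=> x y /set1P -> /set1P ->; rewrite eqxx.
have c2 : clique (b |: [set c]) by apply: clique_setU1 => // y /set1P ->.
have c3 : clique (a |: (b |: [set c])).
  by apply: clique_setU1 => // y /setU1P[->//|/set1P ->].
have c4 : clique (i |: (a |: (b |: [set c]))).
  by apply: clique_setU1 => // y /setU1P[->//|/setU1P[->//|/set1P ->]].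
have := Qmax (q := i) _ iQ c4; rewrite !inE eqxx => /(_ isT).
by rewrite !cardsU1 cards1 !inE !negb_or ia ib ic ab ac bc s3.
Qed.

(** The hypotheses determine all remaining adjacencies; then b - f - a + c has norm (5 + 5 + 4 + 4)
    - 2 * (1 + 2 + 2 + 2 + 2) = 0. *)
Lemma four_outside3 i a b c f : s = 3%N -> i \in Q -> clique (private i) ->
  uniq [:: i; a; b; c; f] -> exotic a -> exotic c -> b \in private i -> f \in private i ->
  h i a -> h i c -> h a b -> h c f -> False.
Proof.
move=> s3 iQ cp u ea ec bp fp hia hic hab hcf.
have [aQ ta ua _] := exotic_bounds ea; have [cQ' tc uc _] := exotic_bounds ec.
have tau2 z : (1 < tau z)%N -> (tau z < s)%N -> tau z = 2%N.
  by move=> lo; rewrite s3 ltnS => hi; apply/eqP; rewrite eqn_leq hi.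
have [ta2 tc2] : tau a = 2%N /\ tau c = 2%N by split; apply: tau2.
move: (bp) (fp); rewrite !inE => /and3P[bQ hbi /eqP tb] /and3P[fQ hfi /eqP tf].
have := u; rewrite /= !inE !negb_or.
move=> /and5P[/and4P[ia ib ic jf] /and3P[ab ac af] /andP[bc bf] cf _].
have hbf : h b f by apply: cp.
have /negbTE hac : ~~ h a c by apply/negP/adjacent_exotics3.
have /negbTE hbc : ~~ h b c.
  apply/negP => hbc; apply: (@no_quad_clique b c f i) => //; try by rewrite // h_sym.
  by rewrite /= !inE !negb_or ib ic jf bc bf cf.
have /negbTE haf : ~~ h a f.
  apply/negP => haf; apply: (@no_quad_clique a b f i) => //; try by rewrite // h_sym.
  by rewrite /= !inE !negb_or ia ib jf ab af bf.
have cac : common Q a c = 1%N.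
  have c0 := exotics_common_gt0 ea ec ac.
  have cl := common_le a c.
  have [||] := @res_bounds a c 4 aQ cQ' ac => //.
    by rewrite /res_norm s3 ta2 tc2.
  by rewrite res_xy // s3 ta2 tc2 hac; move: c0 cl; rewrite ta2; clear; lia.
have := @res_quad_pos Q [:: (1, b); (-1, f); (-1, a); (1, c)] cQ.
rewrite /= !inE !negb_or bf bc (eq_sym b) ab (eq_sym f a) af (eq_sym f c) cf ac.
rewrite aQ bQ cQ' fQ /= => /(_ isT isT isT); rewrite !(big_cons, big_nil).
rewrite /res_norm !res_xy // 1?eq_sym // !(common1 _ iQ hbi) // !(common1 _ iQ hfi) //.
rewrite cac ta2 tb tc2 tf s3 hbf hac hbc (h_sym b) hab (h_sym f a) haf (h_sym f c) hcf.
by rewrite hfi (h_sym a) hia (h_sym c) hic; vm_compute.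
Qed.

(** Choose [i] in [Q] with [private i] a clique, hence of size at most 2. The two other lines
    through [i] carry four outside points; no line has two exotic ones, so each has one exotic and
    one private point. *)
Lemma closed3_line l0 : s = 3%N -> (forall x, e l0 x -> x \in Q) -> False.
Proof.
move=> s3 l0Q.
have Ql0 x : x \in Q -> e l0 x.
  have /eqP E : [set x | e l0 x] == Q.
    rewrite eqEcard e_reg k3 s3 leqnn andbT; apply/subsetP => y; rewrite inE.
    exact: l0Q.
  by rewrite -E inE.
have [i iQ cp] : exists2 i, i \in Q & clique (private i).
  have [q qQ] := card_gt0P Q_gt0.
  have [|q' q'Q] := @exists_notin Q [set q]; first by rewrite cards1 s3.
  rewrite inE => qq'; have [] := private_clique q'Q qQ qq'; first by exists q'.
  by exists q.
have l0i := Ql0 _ iQ.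
have [m [im ml _]] := third_point i l0 l0.
have [m' [im' m'l m'm]] := third_point i l0 m.
rewrite e_sym in im; rewrite e_sym in im'.
have [a [ma ai _]] := third_point m i i.
have [b [mb bi ba]] := third_point m i a.
have [c [mc ci _]] := third_point m' i i.
have [f [mf fi fc]] := third_point m' i c.
have out n x : e n i -> n != l0 -> e n x -> x != i -> x \notin Q.
  move=> ni nl nx xi; apply: contraNN nl => /Ql0 lx.
  by apply/eqP; apply: (e_girth xi).
have [aQ bQ cQ' fQ] : [/\ a \notin Q, b \notin Q, c \notin Q & f \notin Q].
  by split; [apply: (out m) | apply: (out m) | apply: (out m') | apply: (out m')].
have ne x y : e m x -> e m' y -> x != i -> x != y.
  by move=> mx my xi; apply: contraNneq m'm => E; apply/eqP/(e_girth xi) => //; rewrite E.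
have [ac af bc bf] : [/\ a != c, a != f, b != c & b != f] by split; apply: ne.
have hi n x : e n i -> e n x -> x != i -> h i x.
  by move=> ni nx xi; apply: (on_line ni) => //; rewrite eq_sym.
have [ha hb hc hf] : [/\ h i a, h i b, h i c & h i f].
  by split; [apply: (hi m) | apply: (hi m) | apply: (hi m') | apply: (hi m')].
have hab : h a b by apply: (on_line ma mb); rewrite eq_sym.
have hcf : h c f by apply: (on_line mc mf); rewrite eq_sym.
have alt x : x \notin Q -> h i x -> exotic x \/ x \in private i.
  move=> xQ hx; have := outside_gt0 iQ xQ hx; rewrite inE /exotic xQ h_sym hx /=.
  by case: (tau x) => [|[|?]] //= _; [right|left].
have u (x y z t : T) : perm_eq [:: x; y; z; t] [:: a; b; c; f] -> uniq [:: i; x; y; z; t].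
  move=> p; rewrite cons_uniq (perm_mem p) (perm_uniq p) /= !inE !negb_or.
  by rewrite !(eq_sym i) ai bi ci fi ac af bc bf eq_sym ba eq_sym fc.
have trip x y z : uniq [:: x; y; z] -> x \in private i -> y \in private i -> z \in private i -> False.
  move=> uxyz xp yp zp; have := clique_private_card iQ cp; rewrite s3.
  have := @size_le_card [:: x; y; z] (private i) uxyz; rewrite /= xp yp zp => /(_ isT).
  by move=> le3; rewrite ltnNge le3.
have adj := adjacent_exotics3 s3.
have [ea|pa] := alt a aQ ha; have [eb|pb] := alt b bQ hb;
  have [ec|pc] := alt c cQ' hc; have [ef|pf] := alt f fQ hf;
  try (by apply: (adj a b)); try (by apply: (adj c f)).
- apply: (@four_outside3 i a b c f) => //; exact: u.
- apply: (@four_outside3 i a b f c) => //; last by rewrite h_sym.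
  by apply: u; apply/permP => p /=; clear; lia.
- by apply: (trip b c f) => //; have := u a b c f (perm_refl _); rewrite /= => /and3P[].
- apply: (@four_outside3 i b a c f) => //; last by rewrite h_sym.
  by apply: u; apply/permP => p /=; clear; lia.
- apply: (@four_outside3 i b a f c) => //; try by rewrite h_sym.
  by apply: u; apply/permP => p /=; clear; lia.
- by apply: (trip a c f) => //; have := u b a c f; rewrite /= => /(_ _)/and3P[] //; apply/permP => p /=; clear; lia.
- by apply: (trip a b f) => //; have := u c a b f; rewrite /= => /(_ _)/and3P[] //; apply/permP => p /=; clear; lia.
- by apply: (trip a b c) => //; have := u f a b c; rewrite /= => /(_ _)/and3P[] //; apply/permP => p /=; clear; lia.
- by apply: (trip a b c) => //; have := u f a b c; rewrite /= => /(_ _)/and3P[] //; apply/permP => p /=; clear; lia.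
Qed.

(** Only 6 - 4 = 2 neighbours of [r] are outside [Q], while outside points on its three lines would
    be distinct. *)
Lemma full_line5 r : s = 5%N -> r \in Q -> exists l, e l r /\ forall x, e l x -> x \in Q.
Proof.
move=> s5 rQ; pose out l := odflt r [pick x | e l x && (x \notin Q)].
case: (boolP [exists l, e l r && [forall x, e l x ==> (x \in Q)]]).
  move=> /existsP[l /andP[lr /forallP H]]; exists l; split=> // x lx.
  by have := H x; rewrite lx.
rewrite negb_exists => /forallP nf.
have outP l : e l r -> e l (out l) /\ out l \notin Q.
  move=> lr; rewrite /out; case: pickP => [x /andP[]//|H].
  have := nf l; rewrite lr /= negb_forall => /existsP[x].
  by rewrite negb_imply H.
have : (#|out @: [set l | e r l]| <= #|[set y | (y \notin Q) && h r y]|)%N.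
  apply: subset_leq_card; apply/subsetP => x /imsetP[l]; rewrite inE e_sym => lr ->.
  have [lo oQ] := outP l lr; rewrite inE oQ; apply: (on_line lr lo).
  by apply: contraNneq oQ => <-.
rewrite card_in_imset; last first.
  move=> l l'; rewrite !inE ![e r _]e_sym => lr lr' E.
  have [lo oQ] := outP l lr; have [lo' _] := outP l' lr'; rewrite -E in lo'.
  by apply: (@e_girth r (out l)) => //; apply: contraNneq oQ => <-.
by rewrite e_reg k3; have := card_outside rQ; rewrite k3 s5 /=; clear; lia.
Qed.

(** * A clique of size 5 as the union of two lines sharing a point *)

Section TwoLines.

Variables (l0 l1 r0 : T).
Hypothesis s5 : s = 5%N.
Hypothesis l0Q : forall x, e l0 x -> x \in Q.
Hypothesis l1Q : forall x, e l1 x -> x \in Q.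
Hypothesis l01 : l0 != l1.
Hypothesis l0r : e l0 r0.
Hypothesis l1r : e l1 r0.

Lemma two_lines_meet x : e l0 x -> e l1 x -> x = r0.
Proof.
move=> a b; apply/eqP; apply: contraT => xr; case/eqP: l01.
exact: (e_girth xr).
Qed.

Lemma cross_point u v u' v' : e l0 u -> e l1 v -> e l0 u' -> e l1 v' ->
  uniq [:: r0; u; u'; v; v'] ->
  exists m x, [/\ e m u, e m v, e m x & x \notin Q].
Proof.
move=> lu lv lu' lv' uq.
have := uq; rewrite /= !inE !negb_or.
move=> /and5P[/and4P[ru ru' rv rv'] /and3P[uu' uv uv'] /andP[u'v u'v'] vv' _].
have inQ : forall q, q \in Q -> q \in [:: r0; u; u'; v; v'].
  by apply: mem_enumeration => //; rewrite /= ?(l0Q l0r) ?(l0Q lu) ?(l0Q lu') ?l1Q ?s5.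
have [_ [m [mu mv]]] := hP _ _ (cQ (l0Q lu) (l1Q lv) uv).
have [x [mx xu xv]] := third_point m u v; exists m, x; split=> //.
have n0 y : e l0 y -> e m y -> y = u.
  move=> ly my; apply/eqP; apply: contraT => yu.
  have E := e_girth yu ly lu my mu; rewrite -E in mv.
  by rewrite (two_lines_meet mv lv) eqxx in rv.
have n1 y : e l1 y -> e m y -> y = v.
  move=> ly my; apply/eqP; apply: contraT => yv.
  have E := e_girth yv ly lv my mv; rewrite -E in mu.
  by rewrite (two_lines_meet lu mu) eqxx in ru.
apply/negP => /inQ; rewrite !inE => /or4P[||| /orP[]] /eqP E; move: mx xu xv; rewrite E.
- by move=> /(n0 _ l0r) ru'' _ _; rewrite ru'' eqxx in ru.
- by rewrite eqxx.
- by move=> /(n0 _ lu') ->; rewrite eqxx.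
- by rewrite eqxx.
- by move=> /(n1 _ lv') ->; rewrite eqxx.
Qed.

Lemma cross_outside u v m x y : e l0 u -> e l1 v -> u != r0 -> v != r0 ->
  e m u -> e m v -> e m x -> x \notin Q -> e m y -> y \notin Q -> x = y.
Proof.
move=> lu lv ur vr mu mv mx xQ my yQ; apply/eqP; apply: contraT => xy.
have uv : u != v by apply: contraNneq ur => E; rewrite E in lu *; rewrite (two_lines_meet lu lv).
have ne q z : q \in Q -> z \notin Q -> q != z by move=> qQ; apply: contraNneq => <-.
have := @size_le_card [:: u; v; x; y] [set z | e m z].
have [uQ vQ] := (l0Q lu, l1Q lv).
rewrite /= !inE !negb_or uv xy !ne // mu mv mx my e_reg k3.
by move=> /(_ isT isT).
Qed.

(** The three lines through [a] are [l0], which has no outside point, and the two cross lines. *)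
Lemma through_cross a b b' m m' y : e l0 a -> e l1 b -> e l1 b' -> b != b' -> a != r0 ->
  b != r0 -> b' != r0 -> e m a -> e m b -> e m' a -> e m' b' -> y \notin Q -> h a y ->
  e m y \/ e m' y.
Proof.
move=> la lb lb' bb' ar br b'r ma mb m'a m'b' yQ /hP[ay [n [na ny]]].
have l0n c p : e l1 c -> c != r0 -> e p c -> l0 != p.
  move=> lc cr pc; apply: contraNneq cr => E; rewrite -E in pc.
  by rewrite (two_lines_meet pc lc).
have mm' : m != m'.
  apply: contraNneq ar => E; rewrite -E in m'b'.
  by rewrite (two_lines_meet la) // (e_girth bb' lb lb' mb m'b').
have : n \in [:: l0; m; m'].
  apply: (@line_mem a); rewrite 1?e_sym //.
  by rewrite /= !inE !negb_or mm' (l0n b) ?(l0n b').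
rewrite !inE => /or3P[] /eqP E; subst n; [|by left|by right].
by rewrite (l0Q ny) in yQ.
Qed.

Lemma cross_nadj a b a' b' m m' x z : e l0 a -> e l1 b -> e l0 a' -> e l1 b' ->
  uniq [:: r0; a; a'; b; b'] -> e m a -> e m b -> e m x -> x \notin Q ->
  e m' a' -> e m' b' -> e m' z -> z \notin Q -> x != z -> ~~ h a' x.
Proof.
move=> la lb la' lb' /=; rewrite !inE !negb_or.
move=> /and5P[/and4P[ra ra' rb rb'] /and3P[aa' ab ab'] /andP[a'b a'b'] bb' _].
rewrite ![r0 == _]eq_sym in ra ra' rb rb'.
move=> ma mb mx xQ m'a m'b m'z zQ xz; apply/negP => hx.
have [_ [n [na nb]]] := hP _ _ (cQ (l0Q la') (l1Q lb) a'b).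
have bx : b != x by apply: contraNneq xQ => <-; apply: l1Q.
have [nx|m'x] := through_cross la' lb lb' bb' ra' rb rb' na nb m'a m'b xQ hx.
  have E := e_girth bx mb mx nb nx; rewrite -E in na.
  have E' := e_girth aa' la la' ma na; rewrite -E' in mb.
  by rewrite (two_lines_meet mb lb) eqxx in rb.
by rewrite (cross_outside la' lb' ra' rb' m'a m'b m'x xQ m'z zQ) eqxx in xz.
Qed.

End TwoLines.

Lemma third_of_line l x : e l x -> exists y z, [/\ e l y, e l z & uniq [:: x; y; z]].
Proof.
move=> lx; have [y [ly yx _]] := third_point l x x.
have [z [lz zx zy]] := third_point l x y.
by exists y, z; split; rewrite //= !inE !negb_or eq_sym yx eq_sym zx eq_sym zy.
Qed.

Lemma not_closed5 : s = 5%N -> False.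
Proof.
move=> s5.
have [r rQ] := card_gt0P Q_gt0.
have [l0 [l0r l0Q]] := full_line5 s5 rQ.
have [|v0 v0Q] := @exists_notin Q [set x | e l0 x]; first by rewrite e_reg k3 s5.
rewrite inE => l0v0; have [l1 [l1v0 l1Q]] := full_line5 s5 v0Q.
have l01 : l0 != l1 by apply: contraNneq l0v0 => ->.
have [r0 l0r0 l1r0] : exists2 r0, e l0 r0 & e l1 r0.
  have : (0 < #|[set x | e l0 x] :&: [set x | e l1 x]|)%N.
    have : (#|[set x | e l0 x] :|: [set x | e l1 x]| <= 5)%N.
      rewrite -s5; apply: subset_leq_card; apply/subsetP => x.
      by rewrite !inE => /orP[]; [apply: l0Q | apply: l1Q].
    by have := cardsUI [set x | e l0 x] [set x | e l1 x]; rewrite !e_reg k3; clear; lia.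
  by move=> /card_gt0P[x]; rewrite !inE => /andP[]; exists x.
have [u [u' [l0u l0u']]] := third_of_line l0r0; rewrite /= !inE !negb_or => /and3P[/andP[ru ru'] uu' _].
have [v [v' [l1v l1v']]] := third_of_line l1r0; rewrite /= !inE !negb_or => /and3P[/andP[rv rv'] vv' _].
have meet := two_lines_meet l01 l0r0 l1r0.
have ne x y : e l0 x -> e l1 y -> r0 != x -> x != y.
  by move=> lx ly; apply: contraNneq => E; apply/eqP/esym/meet => //; rewrite E.
have cross a b a' b' : e l0 a -> e l1 b -> e l0 a' -> e l1 b' ->
    [&& r0 != a, r0 != a', r0 != b, r0 != b', a != a' & b != b'] ->
  exists m x, [/\ e m a, e m b, e m x & x \notin Q].
  move=> la lb la' lb' /and5P[ra ra' rb rb' /andP[aa' bb']].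
  apply: (cross_point s5 l0Q l1Q l01 l0r0 l1r0 la lb la' lb').
  by rewrite /= !inE !negb_or ra ra' rb rb' aa' bb' (ne a b) ?(ne a b') ?(ne a' b) ?(ne a' b').
have nbQ q x m : q \in Q -> x \notin Q -> e m q -> e m x -> h x q.
  by move=> qQ xQ mq mx; apply: (on_line mx mq); apply: contraNneq xQ => ->.
(* Opposite cross lines have the same outside point. Otherwise [r0] would be the only common
   neighbour of the two, each would have [tau] = 3, and [exotic_res5] forbids two exotic vertices of
   norm 3. *)
have opp a b a' b' m x m' z : e l0 a -> e l1 b -> e l0 a' -> e l1 b' ->
    [&& r0 != a, r0 != a', r0 != b, r0 != b', a != a' & b != b'] ->
    e m a -> e m b -> e m x -> x \notin Q -> e m' a' -> e m' b' -> e m' z -> z \notin Q -> x = z.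
  move=> la lb la' lb' /and5P[ra ra' rb rb' /andP[aa' bb']] ma mb mx xQ m'a m'b m'z zQ.
  have uq : uniq [:: r0; a; a'; b; b'].
    by rewrite /= !inE !negb_or ra ra' rb rb' aa' bb' (ne a b) ?(ne a b') ?(ne a' b) ?(ne a' b').
  have inQ : forall q, q \in Q -> q \in [:: r0; a; a'; b; b'].
    apply: mem_enumeration => //; last by rewrite s5.
    by rewrite /= (l0Q _ l0r0) (l0Q _ la) (l0Q _ la') (l1Q _ lb) (l1Q _ lb').
  apply/eqP; apply: contraT => xz.
  have zx : z != x by rewrite eq_sym.
  have pu L : perm_eq L [:: r0; a; a'; b; b'] -> uniq L by move=> /perm_uniq ->.
  have uq2 : uniq [:: r0; a'; a; b'; b] by apply: pu; apply/permP => p /=; clear; lia.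
  have uq3 : uniq [:: r0; b; b'; a; a'] by apply: pu; apply/permP => p /=; clear; lia.
  have uq4 : uniq [:: r0; b'; b; a'; a] by apply: pu; apply/permP => p /=; clear; lia.
  have l10 : l1 != l0 by rewrite eq_sym.
  have n1 := cross_nadj l0Q l1Q l01 l0r0 l1r0 la lb la' lb' uq ma mb mx xQ m'a m'b m'z zQ xz.
  have n2 := cross_nadj l0Q l1Q l01 l0r0 l1r0 la' lb' la lb uq2 m'a m'b m'z zQ ma mb mx xQ zx.
  have n3 := cross_nadj l1Q l0Q l10 l1r0 l0r0 lb la lb' la' uq3 mb ma mx xQ m'b m'a m'z zQ xz.
  have n4 := cross_nadj l1Q l0Q l10 l1r0 l0r0 lb' la' lb la uq4 m'b m'a m'z zQ mb ma mx xQ zx.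
  have ex : exotic x.
    by apply: (@outside_line_exotic m x a b) => //; [apply: l0Q|apply: l1Q|apply: ne].
  have ez : exotic z.
    by apply: (@outside_line_exotic m' z a' b') => //; [apply: l0Q|apply: l1Q|apply: ne].
  have := exotics_common_gt0 ex ez xz; rewrite commonE => /card_gt0P[q].
  rewrite inE => /and3P[qQ hxq hzq].
  have qr : q = r0.
    move: (inQ q qQ) hxq hzq; rewrite !inE => /or4P[/eqP //||| /orP[]] /eqP ->;
      by rewrite ?(h_sym x) ?(h_sym z) ?(negPf n1) ?(negPf n2) ?(negPf n3) ?(negPf n4).
  have r0Q : r0 \in Q by apply: l0Q.
  have tau3 y c c' f f' : uniq [:: r0; c; f] -> c \in Q -> f \in Q -> h y r0 -> h y c -> h y f ->
      ~~ h c' y -> ~~ h f' y -> (forall q, q \in Q -> q \in [:: r0; c; c'; f; f']) -> tau y = 3%N.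
    move=> u3 cQ3 fQ3 y0 yc yf yc' yf' inQ3; rewrite nbrsE.
    have -> : [set t in Q | h y t] = [set t in [:: r0; c; f]].
      apply/setP => t; rewrite !inE; apply/andP/idP => [[/inQ3]|].
        rewrite !inE => /or4P[->//|->|| /orP[]]; rewrite ?orbT // => /eqP ->.
        - by rewrite h_sym (negPf yc').
        - by rewrite eqxx ?orbT.
        - by rewrite h_sym (negPf yf').
      by move=> /or3P[] /eqP ->.
    by rewrite cardsE (card_uniqP u3).
  have tx : tau x = 3%N.
    apply: (tau3 x a a' b b') => //; try (by apply: l0Q); try (by apply: l1Q).
    - by rewrite /= !inE !negb_or ra rb ne.
    - by rewrite -qr.
    - by apply: (nbQ a x m) => //; apply: l0Q.
    - by apply: (nbQ b x m) => //; apply: l1Q.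
  have tz : tau z = 3%N.
    apply: (tau3 z a' a b' b) => //; try (by apply: l0Q); try (by apply: l1Q).
    - by rewrite /= !inE !negb_or ra' rb' ne.
    - by rewrite -qr.
    - by apply: (nbQ a' z m') => //; apply: l0Q.
    - by apply: (nbQ b' z m') => //; apply: l1Q.
    - move=> t /inQ; rewrite !inE => /or4P[->//|->|->| /orP[] ->]; by rewrite ?orbT.
  by case: (exotic_res5 s5 ex ez xz) => [[+ _ _]|[+ _]|[_ +]]; rewrite /res_norm ?tx ?tz s5.
have C1 : [&& r0 != u, r0 != u', r0 != v, r0 != v', u != u' & v != v'].
  by rewrite ru ru' rv rv' uu'.
have C2 : [&& r0 != u, r0 != u', r0 != v', r0 != v, u != u' & v' != v].
  by rewrite ru ru' rv rv' uu' eq_sym.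
have C3 : [&& r0 != u', r0 != u, r0 != v', r0 != v, u' != u & v' != v].
  by rewrite ru ru' rv rv' eq_sym uu' eq_sym.
have C4 : [&& r0 != u', r0 != u, r0 != v, r0 != v', u' != u & v != v'].
  by rewrite ru ru' rv rv' eq_sym uu'.
have [m1 [x [m1u m1v m1x xQ]]] := cross _ _ _ _ l0u l1v l0u' l1v' C1.
have [m2 [y [m2u m2v m2y yQ]]] := cross _ _ _ _ l0u l1v' l0u' l1v C2.
have [m3 [z [m3u m3v m3z zQ]]] := cross _ _ _ _ l0u' l1v' l0u l1v C3.
have [m4 [w [m4u m4v m4w wQ]]] := cross _ _ _ _ l0u' l1v l0u l1v' C4.
have xz := opp _ _ _ _ _ _ _ _ l0u l1v l0u' l1v' C1 m1u m1v m1x xQ m3u m3v m3z zQ.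
have yw := opp _ _ _ _ _ _ _ _ l0u l1v' l0u' l1v C2 m2u m2v m2y yQ m4u m4v m4w wQ.
subst z w.
have [uQ u'Q vQ v'Q] : [/\ u \in Q, u' \in Q, v \in Q & v' \in Q].
  by split; [apply: l0Q|apply: l0Q|apply: l1Q|apply: l1Q].
have xy : x != y.
  apply: contraNneq rv => E; rewrite -E in m2y.
  have ux : u != x by apply: contraNneq xQ => <-.
  have E' := e_girth ux m1u m1x m2u m2y; rewrite -E' in m2v.
  have E2 := e_girth vv' m1v m2v l1v l1v'; rewrite E2 in m1u.
  by rewrite (meet u l0u m1u) eqxx in ru.
have hx : {in [:: u; u'; v; v'], forall q, h x q}.
  move=> q; rewrite !inE => /or4P[] /eqP ->.
  - exact: (nbQ u x m1).
  - exact: (nbQ u' x m3).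
  - exact: (nbQ v x m1).
  - exact: (nbQ v' x m3).
have hy : {in [:: u; u'; v; v'], forall q, h y q}.
  move=> q; rewrite !inE => /or4P[] /eqP ->.
  - exact: (nbQ u y m2).
  - exact: (nbQ u' y m4).
  - exact: (nbQ v y m4).
  - exact: (nbQ v' y m2).
have c4 : (4 <= common Q x y)%N.
  rewrite commonE; apply: (@size_le_card [:: u; u'; v; v']).
    rewrite /= !inE !negb_or uu' vv'.
    by rewrite (ne u v) ?(ne u v') ?(ne u' v) ?(ne u' v').
  by apply/allP => q qL; rewrite /= !inE hx ?hy // !andbT; move: q qL; apply/allP; rewrite /= uQ u'Q vQ v'Q.
have tau4 t : (4 <= tau t)%N -> t \notin Q -> tau t = 4%N.
  move=> t4 tQ; have := nbrs_lt tQ; rewrite s5 ltnS => /(_ (leq_trans _ t4)) t4'.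
  by apply/eqP; rewrite eqn_leq t4' //.
have tx : tau x = 4%N by apply: tau4 => //; apply: leq_trans c4 (common_le x y).
have ty : tau y = 4%N by apply: tau4 => //; apply: leq_trans c4 (common_le_r x y).
have c4' : common Q x y = 4%N.
  by apply/eqP; rewrite eqn_leq c4 andbT -tx common_le.
(* Both vertices have the same four neighbours in [Q]: adjacent, they give a clique of size 6;
   otherwise the product is 16 - 24 = -8. *)
have [|] := boolP (h x y) => hxy.
  by have := common_lt xQ yQ hxy; rewrite c4' s5 => /(_ isT).
have [||] := @res_bounds x y 4 xQ yQ xy => //.
  by rewrite /res_norm s5 tx ty.
by rewrite res_xy // s5 tx ty c4' (negPf hxy).
Qed.

Lemma line_lines x l l' l'' t : e l x -> e l' x -> e l'' x -> uniq [:: l; l'; l''] ->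
  e t x -> t \in [:: l; l'; l''].
Proof. by rewrite !(e_sym _ x); apply: line_mem. Qed.

(** Otherwise every line meets [Q] in at most two points. The outside points of the lines [ab] and
    [cf] are then distinct exotic vertices without a common neighbour in [Q]. *)
Lemma exists_line4 : s = 4%N -> exists l, forall x, e l x -> x \in Q.
Proof.
move=> s4; case: (boolP [exists l, [forall x, e l x ==> (x \in Q)]]).
  by move=> /existsP[l /forallP H]; exists l => x lx; have := H x; rewrite lx.
rewrite negb_exists => /forallP nf.
have {}nf l : exists2 x, e l x & x \notin Q.
  have := nf l; rewrite negb_forall => /existsP[x].
  by rewrite negb_imply => /andP[]; exists x.
have nf3 l x y z : uniq [:: x; y; z] -> x \in Q -> y \in Q -> z \in Q ->
    e l x -> e l y -> e l z -> False.
  move=> u xQ yQ zQ lx ly lz; have [t lt tQ] := nf l.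
  have := line_mem lx ly lz u lt; rewrite !inE.
  by move=> /or3P[] /eqP E; rewrite E ?xQ ?yQ ?zQ in tQ.
exfalso; have : (4 <= s)%N by rewrite s4.
move=> /card_geqP[[|a [|b [|c [|f [|? ?]]]]] []] // u _ /allP subQ.
have inQ : forall q, q \in Q -> q \in [:: a; b; c; f].
  by apply: mem_enumeration; rewrite ?s4.
move: u subQ; rewrite /= !inE !negb_or.
move=> /and4P[/and3P[ab ac af] /andP[bc bf] cf _] /and5P[aQ bQ cQ' fQ _].
have neQ q x : q \in Q -> x \notin Q -> q != x by move=> qQ; apply: contraNneq => <-.
(* The lines through [p1] are those to [p2], [p3] and [p4]. On the first, [y] would be a fourth
   point; on the others, it would put [p1] on [m']. *)
have nadj p1 p2 p3 p4 m m' x y : uniq [:: p1; p2; p3; p4] ->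
    p1 \in Q -> p2 \in Q -> p3 \in Q -> p4 \in Q ->
    e m p1 -> e m p2 -> e m x -> x \notin Q -> e m' p3 -> e m' p4 -> e m' y -> y \notin Q ->
    x != y -> ~~ h y p1.
  move=> uq p1Q p2Q p3Q p4Q m1 m2 mx xQ m'3 m'4 m'y yQ xy; apply/negP => hy.
  move: (uq); rewrite /= !inE !negb_or.
  move=> /and4P[/and3P[p12 p13 p14] /andP[p23 p24] p34 _].
  have [_ [l [ly l1]]] := hP _ _ hy.
  have [_ [n3 [n31 n33]]] := hP _ _ (cQ p1Q p3Q p13).
  have [_ [n4 [n41 n44]]] := hP _ _ (cQ p1Q p4Q p14).
  have L : l \in [:: m; n3; n4].
    apply: (@line_lines p1) => //; rewrite /= !inE !negb_or.
    apply/and3P; split=> //; first (apply/andP; split).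
    - apply/eqP => E; apply: (@nf3 m p1 p2 p3) => //; rewrite ?E //.
      by rewrite /= !inE !negb_or p12 p13 p23.
    - apply/eqP => E; apply: (@nf3 m p1 p2 p4) => //; rewrite ?E //.
      by rewrite /= !inE !negb_or p12 p14 p24.
    - apply/eqP => E; apply: (@nf3 n3 p1 p3 p4) => //; rewrite ?E //.
      by rewrite /= !inE !negb_or p13 p14 p34.
  move: L; rewrite !inE => /or3P[] /eqP E; subst l.
  - have := @size_le_card [:: p1; p2; x; y] [set z | e m z].
    rewrite /= !inE !negb_or p12 xy (neQ p1 x) // (neQ p1 y) // (neQ p2 x) // (neQ p2 y) //.
    by rewrite m1 m2 mx ly e_reg k3 => /(_ isT isT).
  - have E := e_girth (neQ _ _ p3Q yQ) m'3 m'y n33 ly.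
    apply: (@nf3 m' p1 p3 p4) => //; rewrite ?E // -?E //.
    by rewrite /= !inE !negb_or p13 p14 p34.
  - have E := e_girth (neQ _ _ p4Q yQ) m'4 m'y n44 ly.
    apply: (@nf3 m' p1 p3 p4) => //; rewrite ?E // -?E //.
    by rewrite /= !inE !negb_or p13 p14 p34.
have [_ [m [ma mb]]] := hP _ _ (cQ aQ bQ ab).
have [_ [m' [mc mf]]] := hP _ _ (cQ cQ' fQ cf).
have [x mx xQ] := nf m; have [y m'y yQ] := nf m'.
have adj q z l : q \in Q -> z \notin Q -> e l q -> e l z -> h z q.
  by move=> qQ zQ lq lz; apply: (on_line lz lq); rewrite eq_sym neQ.
have ex : exotic x by apply: (@outside_line_exotic m x a b).
have ey : exotic y by apply: (@outside_line_exotic m' y c f).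
have [E|xy] := eqVneq x y.
  have [_ _ ts _] := exotic_bounds ex; move: ts; rewrite s4 ltnNge => /negP; apply.
  rewrite nbrsE; apply: (@size_le_card [:: a; b; c; f]).
    by rewrite /= !inE !negb_or ab ac af bc bf cf.
  rewrite /= !inE aQ bQ cQ' fQ (adj a x m) // (adj b x m) //.
  by rewrite (adj c x m') ?(adj f x m') // E.
have pu L : perm_eq L [:: a; b; c; f] -> uniq L.
  by move=> /perm_uniq ->; rewrite /= !inE !negb_or ab ac af bc bf cf.
have n1 : ~~ h y a.
  by apply: (@nadj a b c f m m' x y) => //; apply: pu.
have n2 : ~~ h y b.
  by apply: (@nadj b a c f m m' x y) => //; apply: pu; apply/permP => p /=; clear; lia.
have n3 : ~~ h x c.
  apply: (@nadj c f a b m' m y x) => //; last by rewrite eq_sym.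
  by apply: pu; apply/permP => p /=; clear; lia.
have n4 : ~~ h x f.
  apply: (@nadj f c a b m' m y x) => //; last by rewrite eq_sym.
  by apply: pu; apply/permP => p /=; clear; lia.
have := exotics_common_gt0 ex ey xy; rewrite commonE => /card_gt0P[q].
rewrite inE => /and3P[/inQ]; rewrite !inE => /or4P[] /eqP ->;
  by rewrite ?(negPf n1) ?(negPf n2) ?(negPf n3) ?(negPf n4).
Qed.

Lemma not_closed4 : s = 4%N -> False.
Proof.
move=> s4; have [l0 l0Q] := exists_line4 s4.
have [|o oQ] := @exists_notin Q [set x | e l0 x]; first by rewrite e_reg k3 s4.
rewrite inE => l0o.
have neQ q x : q \in Q -> x \notin Q -> q != x by move=> qQ; apply: contraNneq => <-.
have oP q : q \in Q -> ~~ e l0 q -> q = o.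
  move=> qQ l0q; apply/eqP; apply: contraT => qo.
  have := @size_le_card [:: o; q] (Q :\: [set y | e l0 y]).
  rewrite /= !inE (eq_sym o) qo l0o l0q oQ qQ => /(_ isT isT).
  rewrite cardsD (setIidPr _) ?e_reg ?k3 ?s4 //.
  by apply/subsetP => y; rewrite inE; apply: l0Q.
(* For [i] on [l0]: the line joining [i] to [o], its third point, and the remaining line through
   [i]. Off [l0] the triple is a dummy. *)
have /fin_all_exists[F FP] : forall i, exists p : T * T * T, e l0 i ->
    [/\ [/\ e p.1.1 o, e p.1.1 i & e p.1.1 p.1.2],
        [/\ p.1.2 \notin Q, p.1.1 != l0 & p.1.2 != i] &
        [/\ e p.2 i, p.2 != l0 & p.2 != p.1.1]].
  move=> i; case: (boolP (e l0 i)) => l0i; last by exists (i, i, i).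
  have oi : o != i by apply: contraNneq l0o => ->.
  have [_ [m [mo mi]]] := hP _ _ (cQ oQ (l0Q _ l0i) oi).
  have [x [mx xo xi]] := third_point m o i.
  have [n [ni nl nm]] := third_point i l0 m.
  have ml : m != l0 by apply: contraNneq l0o => <-.
  exists (m, x, n) => _; split=> //=; last by split=> //; rewrite e_sym.
  split=> //; apply/negP => xQ; have [l0x|/(oP _ xQ) E] := boolP (e l0 x).
    by rewrite (e_girth xi mx mi l0x l0i) eqxx in ml.
  by rewrite E eqxx in xo.
pose m i := (F i).1.1; pose x i := (F i).1.2; pose n i := (F i).2.
have {}FP i : e l0 i -> [/\ [/\ e (m i) o, e (m i) i & e (m i) (x i)],
    [/\ x i \notin Q, m i != l0 & x i != i] & [/\ e (n i) i, n i != l0 & n i != m i]].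
  exact: FP.
have adj q z l : q \in Q -> z \notin Q -> e l q -> e l z -> h z q.
  by move=> qQ zQ lq lz; apply: (on_line lz lq); rewrite eq_sym neQ.
have oi i : e l0 i -> o != i by move=> l0i; apply: contraNneq l0o => ->.
have ex i : e l0 i -> exotic (x i).
  move=> l0i; have [[mo mi mx] [xQ _ _] _] := FP i l0i.
  by apply: (@outside_line_exotic (m i) (x i) o i) => //; [apply: l0Q | apply: oi].
have x_inj i j : e l0 i -> e l0 j -> i != j -> x i != x j.
  move=> l0i l0j ij; have [[mo mi mx] [xQ ml _] _] := FP i l0i.
  have [[m'o m'j m'x] _ _] := FP j l0j.
  apply: contra ml => /eqP E; rewrite -E in m'x.
  have E' := e_girth (neQ _ _ oQ xQ) mo mx m'o m'x; rewrite -E' in m'j.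
  by apply/eqP; apply: (e_girth ij).
have /card_geqP[[|a [|b [|c [|? ?]]]] []] // : (3 <= #|[set i | e l0 i]|)%N by rewrite e_reg k3.
rewrite /= !inE negb_or => /and3P[/andP[ab ac] bc _] _ /allP.
rewrite /= !inE => /and4P[l0a l0b l0c _].
pose xs := [:: x a; x b; x c].
have xsP y : y \in xs -> exists2 j, e l0 j & y = x j.
  by rewrite !inE => /or3P[] /eqP ->; [exists a | exists b | exists c].
(* Besides the three exotic vertices of [xs], [five_outside] leaves room for only one outside vertex
   adjacent to [Q]. *)
have five v w : v \notin Q -> w \notin Q -> (0 < tau v)%N -> (0 < tau w)%N ->
    v \notin xs -> w \notin xs -> v = w.
  move=> vQ wQ tv tw vx wx; apply/eqP; apply: contraT => vw.
  have := @five_outside (x a) (x b) (x c) v w s4 (ex _ l0a) (ex _ l0b) (ex _ l0c) vQ wQ tv tw.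
  move: vx wx; rewrite !inE !negb_or ![v == _]eq_sym ![w == _]eq_sym.
  move=> /and3P[va vb vc] /and3P[wa wb wc]; case.
  by rewrite /= !inE !negb_or !x_inj // va vb vc wa wb wc vw.
have outn i y : e l0 i -> e (n i) y -> y != i -> y \notin Q.
  move=> l0i ny yi; have [[mo mi _] _ [ni nl nm]] := FP i l0i.
  apply/negP => yQ; have [l0y|/(oP _ yQ) E] := boolP (e l0 y).
    by rewrite (e_girth yi ny ni l0y l0i) eqxx in nl.
  by rewrite E in ny yi; rewrite (e_girth yi ny ni mo mi) eqxx in nm.
have tau3 y p q r' : y \notin Q -> uniq [:: p; q; r'] -> p \in Q -> q \in Q -> r' \in Q ->
    h y p -> h y q -> h y r' -> tau y = 3%N.
  move=> yQ u pQ qQ rQ hp hq hr.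
  have t3 : (3 <= tau y)%N.
    rewrite nbrsE; apply: (@size_le_card [:: p; q; r']) => //.
    by rewrite /= !inE pQ qQ rQ hp hq hr.
  have t4 : (tau y < 4)%N by rewrite -s4; apply: nbrs_lt => //; apply: leq_trans t3.
  by apply/eqP; rewrite eqn_leq t3 -ltnS t4.
have taux i j : e l0 i -> e l0 j -> e (n i) (x j) -> tau (x j) = 3%N.
  move=> l0i l0j nx; have [[mo mi mx] _ [ni nl nm]] := FP i l0i.
  have [[m'o m'j m'x] [x'Q _ _] _] := FP j l0j.
  have ij : i != j.
    apply: contraNneq nm => E; rewrite -E in nx x'Q.
    by apply/eqP; apply: (e_girth (neQ i (x i) _ _)) => //; apply: l0Q.
  apply: (@tau3 _ o i j) => //; try exact: l0Q.
  - by rewrite /= !inE !negb_or ij !oi.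
  - exact: (adj o _ (m j)).
  - by apply: (adj i _ (n i)) => //; apply: l0Q.
  - by apply: (adj j _ (m j)) => //; apply: l0Q.
have vex i : e l0 i -> exists v w, [/\ e (n i) v, e (n i) w & [/\ v != i, w != i, v != w & v \notin xs]].
  move=> l0i; have [p [np pi _]] := third_point (n i) i i.
  have [q [nq qi qp]] := third_point (n i) i p.
  have [/xsP[j l0j pE]|px] := boolP (p \in xs); last by exists p, q; split=> //; split=> //; rewrite eq_sym.
  have [/xsP[j' l0j' qE]|qx] := boolP (q \in xs); last by exists q, p.
  have hpq : h p q by apply: (on_line np nq); rewrite eq_sym.
  rewrite pE qE in np nq hpq.
  by have := exotic3_nadj s4 (ex _ l0j) (ex _ l0j') (taux i j l0i l0j np) (taux i j' l0i l0j' nq);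
    rewrite hpq.
have tpos i y : e l0 i -> e (n i) y -> y != i -> (0 < tau y)%N.
  move=> l0i ny yi; have [_ _ [ni _ _]] := FP i l0i.
  apply: (@outside_gt0 i); [exact: l0Q|exact: outn ny yi|].
  by apply: (on_line ni ny); rewrite eq_sym.
(* All three lines [n a], [n b], [n c] pass through the same [v], so [tau v] = 3. The other point
   [w] of [n a] must be in [xs], with [tau w] = 3, and [exotic3_nadj] is violated. *)
have [v [w [nv nw [va wa vw vx]]]] := vex a l0a.
have [v2 [_ [nv2 _ [v2b _ _ v2x]]]] := vex b l0b.
have [v3 [_ [nv3 _ [v3c _ _ v3x]]]] := vex c l0c.
have vQ := outn a v l0a nv va; have wQ := outn a w l0a nw wa.
have E2 : v2 = v by apply: five => //; [apply: (outn b)|apply: (tpos b)|apply: (tpos a)].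
have E3 : v3 = v by apply: five => //; [apply: (outn c)|apply: (tpos c)|apply: (tpos a)].
subst v2 v3.
have tv : tau v = 3%N.
  have [_ _ [na _ _]] := FP a l0a; have [_ _ [nb _ _]] := FP b l0b.
  have [_ _ [nc _ _]] := FP c l0c.
  apply: (@tau3 _ a b c) => //; try exact: l0Q.
  - by rewrite /= !inE !negb_or ab ac bc.
  - by apply: (adj a _ (n a)) => //; apply: l0Q.
  - by apply: (adj b _ (n b)) => //; apply: l0Q.
  - by apply: (adj c _ (n c)) => //; apply: l0Q.
have [/xsP[j l0j wE]|wx] := boolP (w \in xs); last first.
  by rewrite (five v w) ?eqxx // in vw; apply: (tpos a).
have hvw : h v w by apply: (on_line nv nw).
have ev : exotic v by rewrite /exotic vQ tv.
rewrite wE in nw hvw.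
by have := exotic3_nadj s4 ev (ex _ l0j) tv (taux a j l0a l0j nw); rewrite hvw.
Qed.

End Cubic.

(** The hypothesis rules out, for k = 3, a triangle of [h] whose points are not on one line;
    [closed3_line] starts from a line. *)
Lemma max_clique_closed : (s = k -> exists l, forall x, e l x -> x \in Q) -> h_closed.
Proof.
move=> lineQ; have [k4|k3] := ltnP 3 k; first exact: closed_ge4.
have {}k3 : k = 3%N by apply/eqP; rewrite eqn_leq k3.
have ks := k_le_s; have dn := degree_neq; have dc := closed_of_degree.
rewrite k3 /= in dn dc ks lineQ.
have [s7|s6] := ltnP 6 s; first exact: dc.
have [s3|[s4|[s5|s6']]] : s = 3%N \/ s = 4%N \/ s = 5%N \/ s = 6%N.
  by move: ks s6; clear; lia.
- by have [l lQ] := lineQ s3; case: (closed3_line k3 s3 lQ).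
- by case: (not_closed4 k3 s4).
- by case: (not_closed5 k3 s5).
- by case: dn; rewrite s6'.
Qed.

End PositiveDefiniteGraph.

(** * From positivity of A^2 - (k - 2) to collinearity of any two vertices on a side *)

Section BipartiteRegular.

Variables (T : finType) (e : rel T) (f : T -> bool) (k : nat).
Implicit Types (x y z l : T).
Hypothesis e_sym : forall x y, e x y = e y x.
Hypothesis e_reg : forall x, #|[set y | e x y]| = k.

Definition codeg x y : nat := \sum_l e l x * e l y.

Lemma codeg_sum (a : T -> int) :
  \sum_l (\sum_x (e l x)%:Z * a x) ^+ 2 = \sum_x \sum_y a x * a y * (codeg x y)%:Z.
Proof.
transitivity (\sum_l \sum_x \sum_y a x * a y * (e l x * e l y)%N%:Z).
  apply: eq_bigr => l _; rewrite expr2 mulr_suml; apply: eq_bigr => x _.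
  by rewrite mulr_sumr; apply: eq_bigr => y _; rewrite PoszM; ring.
rewrite exchange_big; apply: eq_bigr => x _; rewrite exchange_big; apply: eq_bigr => y _ /=.
by rewrite -mulr_sumr /codeg (big_morph Posz PoszD (erefl _)).
Qed.

Lemma codeg_xx x : codeg x x = k.
Proof.
rewrite -(e_reg x) -sum1_card big_mkcond; apply: eq_bigr => l _.
by rewrite inE e_sym; case: (e x l).
Qed.

Lemma codeg_sym x y : codeg x y = codeg y x.
Proof. by apply: eq_bigr => l _; rewrite mulnC. Qed.

Hypothesis k_ge3 : (2 < k)%N.
Hypothesis e_pos : forall a : T -> int, (exists x, a x != 0) ->
  (k - 2)%N%:Z * (\sum_x a x ^+ 2) < \sum_l (\sum_x (e l x)%:Z * a x) ^+ 2.

(** On the difference of two unit vectors positivity reads 2 (k - 2) < 2 (k - [codeg x y]). *)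
Lemma codeg_le1 x y : x != y -> (codeg x y <= 1)%N.
Proof.
move=> xy; pose a z : int := (z == x)%:Z - (z == y)%:Z.
have ax : a x = 1 by rewrite /a eqxx (negPf xy).
have ay : a y = -1 by rewrite /a eqxx eq_sym (negPf xy).
have sumE (F : T -> int) : \sum_z a z * F z = F x - F y.
  rewrite (bigD1 x) // (bigD1 y) 1?eq_sym //= big1 => [|z /andP[/negPf zx /negPf zy]].
    by rewrite ax ay mul1r mulN1r addr0.
  by rewrite /a zx zy mul0r.
have := e_pos (a := a); rewrite codeg_sum => /(_ (ex_intro _ x _)); rewrite ax => /(_ isT).
have -> : \sum_z a z ^+ 2 = 2.
  by rewrite (eq_bigr (fun z => a z * a z)) // sumE ax ay.
have -> : \sum_z \sum_w a z * a w * (codeg z w)%:Z = 2 * (k%:Z - (codeg x y)%:Z).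
  transitivity (\sum_z a z * ((codeg z x)%:Z - (codeg z y)%:Z)).
    by apply: eq_bigr => z _; rewrite -(sumE (fun w => (codeg z w)%:Z)) mulr_sumr; apply: eq_bigr => w _; rewrite mulrA.
  by rewrite sumE !codeg_xx (codeg_sym y x); ring.
by move: k_ge3; clear; lia.
Qed.

Lemma no_four_cycle x y l l' : x != y -> e l x -> e l y -> e l' x -> e l' y -> l = l'.
Proof.
move=> xy lx ly l'x l'y; apply/eqP; apply: contraT => ll'.
have := codeg_le1 xy; rewrite /codeg (bigD1 l) //= (bigD1 l') 1?eq_sym //=.
by rewrite lx ly l'x l'y.
Qed.

Definition collinear x y := (x != y) && [exists l, e l x && e l y].

Lemma collinear_sym x y : collinear x y = collinear y x.
Proof. by rewrite /collinear eq_sym; under eq_existsb => l do rewrite andbC. Qed.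

Lemma collinear_irr x : collinear x x = false.
Proof. by rewrite /collinear eqxx. Qed.

Lemma codeg_collinear x y : x != y -> codeg x y = collinear x y.
Proof.
move=> xy; rewrite /collinear xy /=; have := codeg_le1 xy.
case: (boolP [exists l, _]) => [/existsP[l /andP[lx ly]]|].
  by rewrite /codeg (bigD1 l) //= lx ly; case: (X in (_ + X)%N).
rewrite negb_exists => /forallP H _; rewrite /codeg big1 // => l _.
by have := H l; case: (e l x); case: (e l y).
Qed.

Lemma collinear_pos (a : T -> int) : (exists x, a x != 0) ->
  0 < \sum_x \sum_y a x * a y * gram collinear x y.
Proof.
move=> /e_pos; rewrite codeg_sum -subr_gt0; congr (0 < _).
rewrite mulr_sumr -sumrB; apply: eq_bigr => x _.
rewrite [X in X - _](bigD1 x) // [RHS](bigD1 x) //= codeg_xx /gram eqxx collinear_irr.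
rewrite addrAC; congr (_ + _).
  by rewrite -subzn 1?ltnW // -[(2 * true + false)%N]/2%N; ring.
apply: eq_bigr => y; rewrite eq_sym => xy.
by rewrite codeg_collinear // (negPf xy).
Qed.

Hypothesis e_col : forall x y, e x y -> f x != f y.

Lemma collinear_col x y : collinear x y -> f x = f y.
Proof.
move=> /andP[_ /existsP[l /andP[/e_col lx /e_col ly]]].
by move: lx ly; case: (f l); case: (f x); case: (f y).
Qed.

Lemma max_clique_ex x : exists Q : {set T},
  [/\ (0 < #|Q|)%N, {in Q, forall y, f y = f x}, clique collinear Q,
      (forall (K : {set T}) q, q \in K -> q \in Q -> clique collinear K -> (#|K| <= #|Q|)%N)
    & #|Q| = k -> exists l, forall y, e l y -> y \in Q].
Proof.
pose P (K : {set T}) := [&& K != set0, [forall y in K, f y == f x] &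
   [forall y in K, forall z in K, (y != z) ==> collinear y z]].
have PK (K : {set T}) : K != set0 -> {in K, forall y, f y = f x} -> clique collinear K -> P K.
  move=> K0 col cK; rewrite /P K0 /=; apply/andP; split.
    by apply/forall_inP => y yK; rewrite col.
  apply/forall_inP => y yK; apply/forall_inP => z zK; apply/implyP; exact: cK.
have P1 : P [set x].
  apply: PK; first by rewrite -card_gt0 cards1.
    by move=> y /set1P ->.
  by move=> y z /set1P -> /set1P ->; rewrite eqxx.
case: (@arg_maxnP _ [set x] P (fun K => #|K|) P1) => Q0 PQ0 max0.
have [l xl] : exists l, e x l.
  have /card_gt0P[l] : (0 < #|[set y | e x y]|)%N by rewrite e_reg ltnW // ltnW.
  by rewrite inE; exists l.
have Pl : P [set y | e l y].
  apply: PK.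
  - by rewrite -card_gt0 e_reg ltnW // ltnW.
  - by move=> y; rewrite inE => /e_col; move/e_col: xl; case: (f x); case: (f l); case: (f y).
  - move=> y z; rewrite !inE => ly lz yz; rewrite /collinear yz /=.
    by apply/existsP; exists l; rewrite ly.
(* A line on the side of [x] is a clique of size k; it replaces [Q0] when that size is maximum. *)
pose Q := if #|Q0| == k then [set y | e l y] else Q0.
have PQ : P Q by rewrite /Q; case: ifP.
have cardQ : #|Q| = #|Q0| by rewrite /Q; case: eqP => // ->.
exists Q; case/and3P: PQ => Q_n0 /forall_inP Qcol /forall_inP Qcl.
have Qcl' : clique collinear Q.
  by move=> y z yQ zQ; apply/implyP; move: z zQ; apply/forall_inP/Qcl.
split=> //.
- by rewrite card_gt0.
- by move=> y /Qcol/eqP.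
- move=> K q qK qQ cK; rewrite cardQ; apply: max0; apply: PK => //.
    by apply/set0Pn; exists q.
  move=> y yK; rewrite -(eqP (Qcol q qQ)); have [->//|yq] := eqVneq y q.
  by apply: collinear_col; apply: cK.
- by rewrite cardQ => E; exists l => y ly; rewrite /Q E eqxx inE.
Qed.

Hypothesis e_conn : forall x y, connect e x y.

Lemma same_side_collinear x y : f x = f y -> x != y -> exists l, e l x /\ e l y.
Proof.
move=> fxy xy; have [Q [Q0 Qcol cQ Qmax lineQ]] := max_clique_ex x.
have hE u v : collinear u v = (u != v) && [exists l, e l u && e l v] by [].
have Qcl := max_clique_closed collinear_sym collinear_irr collinear_pos cQ Qmax
  e_sym e_reg no_four_cycle hE k_ge3 Q0 lineQ.
have inQ z : f z = f x -> z \in Q.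
  move=> fz; have [q qQ] := card_gt0P Q0.
  (* Two steps from [Q] lead back to [Q], so [A] is closed under [e] and contains every vertex; its
     part on the side of [x] is [Q]. *)
  pose A : {pred T} := [pred z | (z \in Q) || [exists q in Q, e q z]].
  have cA : closed e A.
    apply: intro_closed; first exact: sym_connect_sym.
    move=> u v euv; rewrite !inE => /orP[uQ|/exists_inP[p pQ pu]].
      by apply/orP; right; apply/exists_inP; exists u.
    apply/orP; left; have [<-//|pv] := eqVneq p v.
    apply: (Qcl p) => //; rewrite /collinear pv; apply/existsP; exists u.
    by rewrite e_sym pu.
  have : z \in A by rewrite -(closed_connect cA (e_conn q z)) inE qQ.
  rewrite inE => /orP[//|/exists_inP[p pQ /e_col]].
  by rewrite fz Qcol // eqxx.
have /andP[_ /existsP[l /andP[lx ly]]] : collinear x y by apply: cQ => //; apply: inQ.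
by exists l.
Qed.

End BipartiteRegular.

(** * The projective plane formed by the two sides *)

Section ProjectivePlane.

Variables (T : finType) (e : rel T) (f : T -> bool) (k : nat) (x0 : T).
Hypothesis e_sym : forall x y, e x y = e y x.
Hypothesis e_reg : forall x, #|[set y | e x y]| = k.
Hypothesis k_ge3 : (2 < k)%N.
Hypothesis e_col : forall x y, e x y -> f x != f y.
Hypothesis e_girth : forall x y l l', x != y ->
  e l x -> e l y -> e l' x -> e l' y -> l = l'.
Hypothesis e_join : forall x y, f x = f y -> x != y -> exists l, e l x /\ e l y.

Definition point : finType := {x | f x}.
Definition line : finType := {x | ~~ f x}.
Definition incident (p : point) (l : line) : bool := e (val p) (val l).

Definition side (x : T) : point + line :=
  (if f x as b return f x = b -> point + line
   then fun fx => inl (exist (fun x => f x) x fx)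
   else fun fx => inr (exist (fun x => ~~ f x) x (negbT fx))) (erefl (f x)).

Definition unside (u : point + line) : T :=
  match u with inl p => val p | inr l => val l end.

Lemma sideK : cancel side unside.
Proof. by move=> x; rewrite /side; move: (erefl (f x)); case: {2 3}(f x). Qed.

Lemma unside_inj : injective unside.
Proof.
move=> [[x fx]|[x fx]] [[y fy]|[y fy]] /= E; subst y.
- by congr inl; apply: val_inj.
- by case/negP: (fy).
- by case/negP: (fx).
- by congr inr; apply: val_inj.
Qed.

Lemma side_bij : bijective side.
Proof. by exists unside; [apply: sideK | apply: inj_can_sym sideK unside_inj]. Qed.

Lemma side_incidence x y : e x y = incidence_rel incident (side x) (side y).
Proof.
rewrite -{1}(sideK x) -{1}(sideK y); move: (side x) (side y).
move=> [[u fu]|[u fu]] [[v fv]|[v fv]] //=; last first.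
- by apply/negbTE/negP => /e_col; rewrite (negPf fu) (negPf fv).
- by apply/negbTE/negP => /e_col; rewrite fu fv.
Qed.

Lemma third x l l' : exists y, [/\ e x y, y != l & y != l'].
Proof.
have /subsetPn[y] : ~~ ([set y | e x y] \subset [set l; l']).
  apply: contraTN k_ge3 => /subset_leq_card; rewrite e_reg cards2 -leqNgt.
  by move/leq_trans; apply; case: (l != l').
by rewrite !inE negb_or => xy /andP[? ?]; exists y.
Qed.

Lemma point_join (p1 p2 : point) : p1 != p2 ->
  exists! l : line, incident p1 l && incident p2 l.
Proof.
move=> p12; have [] := @e_join (val p1) (val p2) _ p12; first by rewrite !(valP (_ : point)).
move=> l [l1 l2]; have fl : ~~ f l by have := e_col l1; rewrite (valP p1); case: (f l).
exists (exist (fun x => ~~ f x) l fl); rewrite /incident.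
split=> [|[l' fl']] /=; rewrite ![e (sval _) _]e_sym ?l1 // => /andP[l'1 l'2].
by apply: val_inj => /=; apply: (e_girth p12).
Qed.

Lemma line_meet (l1 l2 : line) : l1 != l2 ->
  exists! p : point, incident p l1 && incident p l2.
Proof.
move=> l12; have [] := @e_join (val l1) (val l2) _ l12.
  by rewrite (negPf (valP l1)) (negPf (valP l2)).
move=> p [p1 p2]; have fp : f p.
  by have := e_col p1; rewrite (negPf (valP l1)); case: (f p).
exists (exist (fun x => f x) p fp); rewrite /incident.
split=> [|[p' fp']] /=; first by rewrite p1.
move=> /andP[p'1 p'2].
by apply: val_inj => /=; apply: (e_girth l12).
Qed.

Lemma card_line (l : line) : #|[set p : point | incident p l]| = k.
Proof.
rewrite -(e_reg (val l)) -(card_imset _ val_inj); apply: eq_card => x.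
apply/imsetP/idP => [[p]|].
  by rewrite !inE => pl ->; rewrite e_sym.
rewrite inE => lx; have fx : f x.
  by have := e_col lx; rewrite (negPf (valP l)); case: (f x).
by exists (exist (fun x => f x) x fx); rewrite // inE /incident e_sym.
Qed.

(** Two points other than [p] on each of two lines through [p]: a line containing both points of one
    pair is that line, and misses the other pair. *)
Lemma quadrangle : exists p1 p2 p3 p4 : point, uniq [:: p1; p2; p3; p4] /\
  forall l : line, (incident p1 l + incident p2 l + incident p3 l + incident p4 l <= 2)%N.
Proof.
have [p fp] : exists p, f p.
  have [y [xy _ _]] := third x0 x0 x0; have H := e_col xy.
  have [fx|/negPf fx] := boolP (f x0); first by exists x0.
  by exists y; move: H; rewrite fx; case: (f y).
have [l1 [pl1 _ _]] := third p p p; have [l2 [pl2 l21 _]] := third p l1 l1.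
have [a [l1a ap _]] := third l1 p p; have [b [l1b bp ba]] := third l1 p a.
have [c [l2c cp _]] := third l2 p p; have [d [l2d dp dc]] := third l2 p c.
rewrite e_sym in pl1; rewrite e_sym in pl2.
have fl l : e l p -> forall x, e l x -> f x.
  by move=> /e_col lp x /e_col; move: lp; rewrite fp; case: (f l); case: (f x).
have off x y : e l1 x -> e l2 y -> x != p -> x != y.
  move=> lx ly xp; apply: contraNneq l21 => E; apply/eqP/esym.
  by apply: (e_girth xp) => //; rewrite E.
have [fa fb] := (fl _ pl1 _ l1a, fl _ pl1 _ l1b).
have [fc fd] := (fl _ pl2 _ l2c, fl _ pl2 _ l2d).
exists (exist (fun x => f x) a fa), (exist (fun x => f x) b fb),
  (exist (fun x => f x) c fc), (exist (fun x => f x) d fd); split.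
  by rewrite /= !inE -!val_eqE /= !negb_or (eq_sym a b) ba (eq_sym c) dc
    (off a c) // (off a d) // (off b c) // (off b d).
case=> l fl' /=; rewrite /incident /= !(e_sym _ l).
have ab : a != b by rewrite eq_sym.
have cd : c != d by rewrite eq_sym.
have off1 y : e l2 y -> y != p -> e l1 y = false.
  by move=> ly yp; apply/negP => l1y; rewrite (e_girth yp l1y pl1 ly pl2) eqxx in l21.
have off2 y : e l1 y -> y != p -> e l2 y = false.
  by move=> ly yp; apply/negP => l2y; rewrite (e_girth yp l2y pl2 ly pl1) eqxx in l21.
have [la|] := boolP (e l a); have [lb|] := boolP (e l b).
- by rewrite (e_girth ab la lb l1a l1b) !off1.
- have [lc|] := boolP (e l c); have [ld|] //= := boolP (e l d).
  by rewrite (e_girth cd lc ld l2c l2d) off2 in la.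
- have [lc|] := boolP (e l c); have [ld|] //= := boolP (e l d).
  by rewrite (e_girth cd lc ld l2c l2d) off2 in lb.
- by case: (e l c); case: (e l d).
Qed.

Lemma incidence_graph : exists (P L : finType) (I : P -> L -> bool),
  projective_plane_of_order I (k - 1) /\
  exists phi : T -> P + L, bijective phi /\
    forall x y, e x y = incidence_rel I (phi x) (phi y).
Proof.
exists point, line, incident; split.
  split; last by move=> l; rewrite card_line subn1 prednK // ltnW // ltnW.
  split; first exact: point_join.
  by split; [exact: line_meet | exact: quadrangle].
by exists side; split; [exact: side_bij | exact: side_incidence].
Qed.

End ProjectivePlane.

(** * Sorted spectra of Hermitian matrices and symmetric spectra *)

Section Spectrum.

Implicit Types (n : nat).
Local Open Scope sesquilinear_scope.

Lemma char_poly_conj (R : fieldType) n (P A : 'M[R]_n) : P \in unitmx ->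
  char_poly (invmx P *m A *m P) = char_poly A.
Proof.
move=> uP; rewrite /char_poly.
have -> : char_poly_mx (invmx P *m A *m P) =
    map_mx polyC (invmx P) *m char_poly_mx A *m map_mx polyC P.
  rewrite /char_poly_mx !map_mxM mulmxBr mulmxBl; congr (_ - _).
  by rewrite scalar_mxC -mulmxA -map_mxM mulVmx // map_mx1 mulmx1.
rewrite !det_mulmx mulrAC -det_mulmx -map_mxM mulVmx // map_mx1 det1 mul1r.
by [].
Qed.

Lemma char_poly_diag (R : fieldType) n (d : 'rV[R]_n) :
  char_poly (diag_mx d) = \prod_(x <- [seq d 0 i | i <- enum 'I_n]) ('X - x%:P).
Proof.
rewrite char_poly_trig ?diag_mx_is_trig // big_map big_enum /=.
by apply: eq_bigr => i _; rewrite mxE eqxx.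
Qed.

Lemma char_poly_spectrum n (A : 'M[algC]_n) :
  char_poly A = \prod_(x <- spectrum A) ('X - x%:P).
Proof.
rewrite /spectrum; case: closed_field_poly_normal => r /= E.
rewrite (perm_big r) ?perm_sort // {1}E.
by rewrite (monicP (char_poly_monic A)) scale1r.
Qed.

Lemma mem_spectrum n (A : 'M[algC]_n) x : (x \in spectrum A) = eigenvalue A x.
Proof. by rewrite eigenvalue_root_char char_poly_spectrum root_prod_XsubC. Qed.

Lemma size_spectrum n (A : 'M[algC]_n) : size (spectrum A) = n.
Proof.
have := size_char_poly A; rewrite char_poly_spectrum size_prod_XsubC.
by case.
Qed.

Lemma hermitian_spectrum n (A : 'M[algC]_n) : A \is hermsymmx ->
  perm_eq (spectrum A) [seq spectral_diag A 0 i | i <- enum 'I_n].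
Proof.
move=> hA; apply: prod_XsubC_eq; rewrite -char_poly_spectrum -char_poly_diag.
rewrite {1}(orthomx_spectralP (hermitian_normalmx hA)).
by rewrite char_poly_conj // spectral_unit.
Qed.

Lemma hermitian_spectrum_real n (A : 'M[algC]_n) : A \is hermsymmx ->
  all (mem Num.real) (spectrum A).
Proof.
move=> hA; rewrite (perm_all _ (hermitian_spectrum hA)) all_map.
apply/allP => i _ /=; have /mxOverP := hermitian_spectral_diag_real hA; exact.
Qed.

Lemma spectrum_sorted n (A : 'M[algC]_n) : A \is hermsymmx ->
  sorted (fun x y : algC => y <= x) (spectrum A).
Proof.
move=> hA; rewrite /spectrum; apply: (@sort_sorted_in _ (mem Num.real)).
  by move=> x y xR yR; rewrite orbC; apply: real_leVge.
by have := hermitian_spectrum_real hA; rewrite /spectrum all_sort.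
Qed.

(* For a bipartite graph, [D] is the diagonal sign matrix of the bipartition. *)
Lemma spectrum_opp n (A D : 'M[algC]_n) : A \is hermsymmx -> D \in unitmx ->
  invmx D *m A *m D = - A -> spectrum A = rev (map -%R (spectrum A)).
Proof.
move=> hA uD DA; apply: (@sorted_eq _ (fun x y : algC => y <= x)).
- by move=> x y z yx xz; apply: le_trans yx.
- by move=> x y /andP[? ?]; apply/le_anti/andP.
- exact: spectrum_sorted.
- rewrite rev_sorted sorted_map; apply: sub_sorted (spectrum_sorted hA) => x y /=.
  by rewrite lerN2.
rewrite perm_sym perm_rev; apply: prod_XsubC_eq.
rewrite -char_poly_spectrum -(char_poly_conj A uD) DA.
have E := orthomx_spectralP (hermitian_normalmx hA).
have -> : - A = invmx (spectralmx A) *m diag_mx (- spectral_diag A) *m spectralmx A.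
  by rewrite {1}E raddfN /= mulmxN mulNmx.
rewrite char_poly_conj ?spectral_unit // char_poly_diag.
rewrite (perm_big _ (perm_map _ (hermitian_spectrum hA))) -map_comp.
by congr (\prod_(x <- _) _); apply: eq_map => i /=; rewrite mxE.
Qed.

Lemma median_le (s : seq algC) n x : size s = n ->
  sorted (fun x y : algC => y <= x) s -> s = rev (map -%R s) -> x \in s ->
  Num.max `|nth 0 s (n.+1)./2.-1| `|nth 0 s (uphalf n.+1).-1| <= `|x|.
Proof.
move=> sz srt sym /(nthP 0)[i]; rewrite sz => lt_i <- {x}.
have mirror j : (j < n)%N -> nth 0 s j = - nth 0 s (n - j.+1).
  by move=> jn; rewrite {1}sym nth_rev size_map sz // (nth_map 0) // sz; move: jn; clear; lia.
have mono j l : (l < n)%N -> (j <= l)%N -> nth 0 s l <= nth 0 s j.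
  move=> ln jl; apply: (@sorted_leq_nth _ (fun x y : algC => y <= x)) => //.
  - by move=> x y z yx xz; apply: le_trans yx.
  - by rewrite inE sz (leq_ltn_trans jl).
  - by rewrite inE sz.
have -> : (uphalf n.+1).-1 = n./2 by [].
have [on|en] := boolP (odd n).
  have E : nth 0 s n./2 = 0.
    have := mirror n./2; have -> : (n - n./2.+1)%N = n./2.
      by rewrite -{1}(odd_double_half n) on -addnn; clear; lia.
    move=> /(_ _)/eqP; rewrite -addr_eq0 -mulr2n mulrn_eq0 /= => H.
    by apply/eqP/H; rewrite -{2}(odd_double_half n) on -addnn; clear; lia.
  have -> : (n.+1)./2.-1 = n./2 by rewrite /= uphalf_half on.
  by rewrite E normr0 maxxx.
have [m nE] : exists m, n = m.+1.*2.
  exists n./2.-1; rewrite prednK; first by rewrite -{1}(odd_double_half n) (negPf en).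
  by move: lt_i; rewrite -{1}(odd_double_half n) (negPf en); case: (n./2).
have -> : (n.+1)./2.-1 = m by rewrite nE /= uphalf_double.
have -> : n./2 = m.+1 by rewrite nE doubleK.
have mn : (m.+1 < n)%N by rewrite nE -addnn; clear; lia.
have M : nth 0 s m = - nth 0 s m.+1.
  by rewrite mirror 1?ltnW // nE; congr (- nth _ _ _); rewrite -addnn; clear; lia.
rewrite M normrN maxxx.
have s0 : nth 0 s m.+1 <= 0.
  have := mono m m.+1 mn (leqnSn m); rewrite M -subr_ge0 -opprD oppr_ge0 -mulr2n.
  by rewrite pmulrn_lle0.
rewrite (ler0_norm s0); have [im|mi] := leqP i m.
  have := mono i m (ltnW mn) im; rewrite M => H.
  by rewrite ger0_norm // (le_trans _ H) // oppr_ge0.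
by have H := mono m.+1 i lt_i mi; rewrite ler0_norm ?lerN2 // (le_trans H).
Qed.

Lemma HL_index_le n (e : rel 'I_n) (x : algC) : adj_mx e \is hermsymmx ->
  spectrum (adj_mx e) = rev (map -%R (spectrum (adj_mx e))) ->
  x \in spectrum (adj_mx e) -> HL_index e <= `|x|.
Proof.
by move=> hA sym xs; apply: median_le; rewrite ?size_spectrum //; apply: spectrum_sorted.
Qed.

Lemma row_normE n (v : 'rV[algC]_n) : (v *m v ^t*) 0 0 = \sum_i `|v 0 i| ^+ 2.
Proof. by rewrite mxE; apply: eq_bigr => i _; rewrite !mxE normCK. Qed.

Lemma unitary_row_norm n (U : 'M[algC]_n) (v : 'rV[algC]_n) : U \is unitarymx ->
  \sum_i `|(v *m U) 0 i| ^+ 2 = \sum_i `|v 0 i| ^+ 2.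
Proof.
move=> uU; rewrite -!row_normE trmx_mul map_mxM mulmxA -[v *m U *m _]mulmxA.
by rewrite (unitarymxP uU) mulmx1.
Qed.

(** In a unitary eigenbasis each coordinate is scaled by an eigenvalue. *)
Lemma hermitian_form_bound n (A : 'M[algC]_n) (c : algC) (v : 'rV[algC]_n) :
  A \is hermsymmx -> 0 <= c -> {in spectrum A, forall x, c <= `|x|} ->
  c ^+ 2 * (\sum_i `|v 0 i| ^+ 2) <= \sum_i `|(v *m A) 0 i| ^+ 2.
Proof.
move=> hA c0 bound; set P := spectralmx A.
have uP : P \is unitarymx by apply: spectral_unitarymx.
have vE : v = v *m P ^t* *m P by rewrite mulmxKtV.
have AE : A = P ^t* *m diag_mx (spectral_diag A) *m P.
  by rewrite -invmx_unitary //; apply/orthomx_spectralP/hermitian_normalmx.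
have -> : v *m A = v *m P ^t* *m diag_mx (spectral_diag A) *m P by rewrite {1}AE !mulmxA.
rewrite {1}vE !(unitary_row_norm _ uP) mulr_sumr.
move: (v *m P ^t* ) => w.
apply: ler_sum => i _; rewrite mul_mx_diag [X in _ <= `|X| ^+ 2]mxE normrM exprMn mulrC ler_wpM2l ?exprn_ge0 //.
rewrite ler_pXn2r ?nnegrE //; apply: bound.
rewrite (perm_mem (hermitian_spectrum hA)); apply/mapP; exists i => //.
by rewrite mem_enum.
Qed.

End Spectrum.

(** * The HL-index as least absolute eigenvalue, and its exact value *)

Section AdjacencyMatrix.

Variables (n k : nat) (e : rel 'I_n) (f : 'I_n -> bool).
Hypothesis e_sym : forall x y, e x y = e y x.
Hypothesis e_col : forall x y, e x y -> f x != f y.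

Local Notation A := (adj_mx e).

Lemma adj_mx_hermitian : A \is hermsymmx.
Proof.
apply/is_hermitianmxP; rewrite expr0 scale1r; apply/matrixP => i j.
by rewrite !mxE conjC_nat e_sym.
Qed.

Lemma adj_mx_spectrum_opp : spectrum A = rev (map -%R (spectrum A)).
Proof.
pose D : 'M[algC]_n := diag_mx (\row_i (-1) ^+ f i).
have DD : D *m D = 1%:M.
  rewrite mul_diag_mx; apply/matrixP => i j; rewrite !mxE mulrnAr -expr2 -exprM mulnC.
  by rewrite exprM sqrrN !expr1n.
have uD : D \in unitmx by case/mulmx1_unit: DD.
apply: (spectrum_opp adj_mx_hermitian uD).
have -> : invmx D = D by rewrite -[LHS]mulmx1 -DD mulmxA mulVmx // mul1mx.
rewrite mul_diag_mx mul_mx_diag; apply/matrixP => i j; rewrite !mxE.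
have [/e_col|] := boolP (e i j); last by rewrite mulr0 mul0r oppr0.
by case: (f i); case: (f j) => //= _; rewrite !(expr0, expr1, mulr1, mul1r).
Qed.

Lemma HL_index_min (x : algC) : x \in spectrum A -> HL_index e <= `|x|.
Proof. exact: HL_index_le adj_mx_hermitian adj_mx_spectrum_opp. Qed.

Lemma HL_index_mem : (0 < n)%N -> exists2 x : algC, x \in spectrum A & HL_index e = `|x|.
Proof.
move=> n0; have mem i : (i < n)%N -> nth 0 (spectrum A) i \in spectrum A.
  by move=> ?; rewrite mem_nth // size_spectrum.
rewrite /HL_index /eig maxEle; case: ifP => _; eexists; try reflexivity; apply: mem.
  by move: n0; rewrite /= -{2}(odd_double_half n) -addnn; case: (odd n); clear; lia.
by rewrite /= uphalf_half; move: n0; rewrite -{1 4}(odd_double_half n) -addnn; case: (odd n); clear; lia.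
Qed.

Hypothesis e_reg : forall x, #|[set y | e x y]| = k.

(** No eigenvalue is smaller in absolute value than the index, so its square bounds the form of A^2
    from below. Restricting to integer vectors moves the inequality from [algC] to [int], where the
    graph arguments take place. *)
Lemma HL_index_form_bound : sqrtC (k - 2)%:R < HL_index e ->
  forall a : 'I_n -> int, (exists x, a x != 0) ->
  (k - 2)%N%:Z * (\sum_x a x ^+ 2) < \sum_l (\sum_x (e l x)%:Z * a x) ^+ 2.
Proof.
move=> HL a [x0 ax0].
have HL0 : 0 <= HL_index e by apply: ltW; apply: le_lt_trans HL; rewrite sqrtC_ge0.
pose v : 'rV[algC]_n := \row_i (a i)%:~R.
have vn : \sum_i `|v 0 i| ^+ 2 = (\sum_x a x ^+ 2)%:~R.
  rewrite rmorph_sum; apply: eq_bigr => i _ /=.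
  by rewrite mxE -intr_norm -rmorphXn /= real_normK ?num_real.
have vAn : \sum_i `|(v *m A) 0 i| ^+ 2 = (\sum_l (\sum_x (e l x)%:Z * a x) ^+ 2)%:~R.
  rewrite rmorph_sum; apply: eq_bigr => i _ /=.
  rewrite -[in RHS]real_normK ?num_real // rmorphXn /= intr_norm; congr (`|_| ^+ 2).
  rewrite mxE rmorph_sum; apply: eq_bigr => j _ /=.
  by rewrite !mxE rmorphM /= mulrC e_sym.
rewrite -(ltr_int algC) -vAn rmorphM /= -vn.
apply: lt_le_trans (hermitian_form_bound v adj_mx_hermitian HL0 HL_index_min).
rewrite ltr_pM2r; last first.
  rewrite vn ltr0z (bigD1 x0) //= ltr_pwDl ?sumr_ge0 // => [|i _]; last by rewrite sqr_ge0.
  by rewrite exprn_even_gt0.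
rewrite -[X in X < _]sqrtCK ltr_pXn2r ?nnegrE ?sqrtC_ge0 ?ler0z //.
Qed.

Hypothesis e_codeg : forall x y, codeg e x y = ((x == y) * k.-1 + (f x == f y))%N.

Lemma adj_mx_sqr (v : 'rV[algC]_n) j :
  (v *m A *m A) 0 j = k.-1%:R * v 0 j + \sum_(i | f i == f j) v 0 i.
Proof.
rewrite -mulmxA mxE.
transitivity (\sum_i v 0 i * (codeg e i j)%:R).
  apply: eq_bigr => i _; rewrite mxE /codeg natr_sum; congr (_ * _).
  by apply: eq_bigr => l _; rewrite !mxE natrM e_sym.
rewrite (eq_bigr (fun i => v 0 i * (i == j)%:R * k.-1%:R + v 0 i * (f i == f j)%:R)); last first.
  by move=> i _; rewrite e_codeg natrD natrM mulrDr mulrA.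
rewrite big_split /=; congr (_ + _).
  rewrite (bigD1 j) //= eqxx mulr1 big1 ?addr0 1?mulrC // => i /negPf ->.
  by rewrite mulr0 mul0r.
by rewrite [RHS]big_mkcond; apply: eq_bigr => i _; case: eqP => _; rewrite ?mulr1 ?mulr0.
Qed.

(** Sum the eigenvector equation of A^2 over a side: a nonzero side sum gives x^2 = k - 1 plus the
    size of that side; if both sums vanish, x^2 = k - 1. *)
Lemma spectrum_norm_ge (x : algC) : x \in spectrum A -> sqrtC k.-1%:R <= `|x|.
Proof.
move=> xs; have xR : x \is Num.real.
  exact: (allP (hermitian_spectrum_real adj_mx_hermitian)).
suff : k.-1%:R <= x ^+ 2.
  by rewrite -real_normK // -{1}[k.-1%:R]sqrtCK ler_pXn2r ?nnegrE ?sqrtC_ge0.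
move: xs; rewrite mem_spectrum => /eigenvalueP[v vA vn0].
pose S b := \sum_(i | f i == b) v 0 i.
have vAA j : x ^+ 2 * v 0 j = k.-1%:R * v 0 j + S (f j).
  by rewrite -adj_mx_sqr vA -scalemxAl vA scalerA mxE expr2.
have [[b Sb]|S0] : (exists b, S b != 0) \/ (forall b, S b = 0).
  have [S1|] := eqVneq (S true) 0; last by left; exists true.
  have [S2|] := eqVneq (S false) 0; last by left; exists false.
  by right; case.
- have : x ^+ 2 * S b = (k.-1%:R + #|[pred i | f i == b]|%:R) * S b.
    transitivity (\sum_(i | f i == b) (k.-1%:R * v 0 i + S b)).
      by rewrite [in LHS]/S mulr_sumr; apply: eq_bigr => i /eqP fi; rewrite vAA fi.
    by rewrite big_split /= -mulr_sumr sumr_const mulrDl [X in _ = _ + X]mulr_natl.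
  by move=> /(mulIf Sb) ->; rewrite lerDl ler0n.
- have /rV0Pn[j vj] := vn0.
  have := vAA j; rewrite S0 addr0 => /(mulIf vj) ->.
  exact: lexx.
Qed.

(** The difference [u] of two unit vectors on one side has side sums 0, so A^2 multiplies it by r^2
    = k - 1. Then u A - r u is zero or an eigenvector for -r. *)
Lemma sqrt_eigenvalue (x y : 'I_n) : f x = f y -> x != y ->
  exists2 z : algC, z \in spectrum A & `|z| = sqrtC k.-1%:R.
Proof.
move=> fxy xy; pose r : algC := sqrtC k.-1%:R.
have r0 : 0 <= r by rewrite sqrtC_ge0.
pose u : 'rV[algC]_n := \row_i ((i == x)%:R - (i == y)%:R).
have un0 : u != 0.
  apply/rV0Pn; exists x; rewrite mxE eqxx (negPf xy) subr0; exact: oner_neq0.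
have delta (a : 'I_n) b : \sum_(i | f i == b) (i == a)%:R = (f a == b)%:R :> algC.
  have [fa|fa] := eqVneq (f a) b.
    rewrite (bigD1 a) ?fa //= eqxx big1 ?addr0 // => i /andP[_ /negPf ->].
    by [].
  rewrite big1 // => i /eqP fi; rewrite (_ : (i == a) = false) //.
  by apply: contraNF fa => /eqP <-; rewrite fi.
have uAA : u *m A *m A = r ^+ 2 *: u.
  apply/rowP => j; rewrite adj_mx_sqr sqrtCK [RHS]mxE.
  rewrite (eq_bigr (fun i => (i == x)%:R - (i == y)%:R)) => [|i _]; last by rewrite mxE.
  by rewrite sumrB !delta fxy subrr addr0.
have [w0|wn0] := eqVneq (u *m A - r *: u) 0.
  exists r; last by rewrite ger0_norm.
  by rewrite mem_spectrum; apply/eigenvalueP; exists u => //; apply/eqP; rewrite -subr_eq0 w0.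
exists (- r); last by rewrite normrN ger0_norm.
rewrite mem_spectrum; apply/eigenvalueP; exists (u *m A - r *: u) => //.
rewrite mulmxBl uAA -scalemxAl scaleNr scalerBr scalerA -expr2 opprB.
by [].
Qed.

End AdjacencyMatrix.

Theorem theorem2p1 (n k : nat) (e : rel 'I_n) :
  simple_graph e -> connected_graph e -> bipartite_graph e ->
  regular_graph e k -> (3 <= k)%N ->
  sqrtC (k - 2)%:R < HL_index e ->
  HL_index e = sqrtC (k - 1)%:R /\
  is_incidence_graph_of_projective_plane e (k - 1).
Proof.
move=> [e_sym _] e_conn [f e_col] e_reg k3 HL.
have n0 : (0 < n)%N.
  (* Without vertices the spectrum is empty and both median entries take the default 0, which does
     not exceed a square root. *)
  case: n e HL {e_sym e_conn f e_col e_reg} => // e.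
  rewrite /HL_index /eig !nth_default ?size_spectrum // normr0 maxxx => H.
  by have := le_lt_trans (_ : 0 <= sqrtC (k - 2)%:R) H; rewrite ltxx sqrtC_ge0 ler0n => /(_ isT).
have pos := HL_index_form_bound e_sym e_col HL.
have girth := no_four_cycle e_sym e_reg k3 pos.
have join := same_side_collinear e_sym e_reg k3 pos e_col e_conn.
have codegE x y : codeg e x y = ((x == y) * k.-1 + (f x == f y))%N.
  have [<-|xy] := eqVneq x y; first by rewrite (codeg_xx e_sym e_reg) eqxx mul1n addn1 prednK // (leq_trans _ k3).
  rewrite mul0n add0n (codeg_collinear e_sym e_reg k3 pos) // /collinear xy /=; congr nat_of_bool.
  apply/existsP/eqP => [[l /andP[/e_col + /e_col]]|fxy].
    by case: (f l); case: (f x); case: (f y).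
  by have [l [lx ly]] := join x y fxy xy; exists l; rewrite lx.
have x0 : 'I_n := Ordinal n0.
split; last exact: incidence_graph x0 e_sym e_reg k3 e_col girth join.
rewrite subn1; apply/eqP; rewrite eq_le; apply/andP; split; last first.
  have [z zs ->] := HL_index_mem e n0.
  exact: (spectrum_norm_ge e_sym codegE zs).
have [x [x0x _ _]] := third e_reg k3 x0 x0 x0.
have [y [x0y yx _]] := third e_reg k3 x0 x x.
have [||z zs <-] := @sqrt_eigenvalue n k e f e_sym codegE x y.
- by move/e_col: x0x; move/e_col: x0y; case: (f x0); case: (f x); case: (f y).
- by rewrite eq_sym.
by have := HL_index_min e_sym e_col zs.
Qed.
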